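(* Let $n>5$ be an integer and let $m$ be the least integer in the set $\{\eta(\alpha^{S_n}\beta^{S_n})\mid \alpha,\beta\in S_n\setminus\{e\}\}$. Then: (i) $m=2$ if $n$ is divisible by $2$ or by $3$; (ii) $m=3$ otherwise.
   Context: $S_n$ is the symmetric group on $n$ letters, with identity $e$. For a finite group $G$ and $a\in G$, $a^G=\{g^{-1}ag\mid g\in G\}$ is the conjugacy class of $a$ in $G$, and for $a,b\in G$, $a^Gb^G=\{xy\mid x\in a^G,\ y\in b^G\}$. This set is invariant under conjugation by $G$, so it is a union of conjugacy classes; $\eta(a^Gb^G)$ denotes the number of distinct conjugacy classes of $G$ contained in it. *)

(* Defs.v *)
From mathcomp Require Import all_boot all_fingroup.

Set Implicit Arguments.
Unset Strict Implicit.
Unset Printing Implicit Defensive.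

Local Open Scope group_scope.

(* Meant for G-invariant A, i.e. for unions of conjugacy classes of G. *)
Definition eta (gT : finGroupType) (G : {group gT}) (A : {set gT}) : nat :=
  #|[set C in classes G | C \subset A]|.

(* x ^: G is the conjugacy class of x in G, and * is the product of sets. *)
Definition eta_values (n : nat) (k : nat) : Prop :=
  exists alpha beta : 'S_n,
    [/\ alpha != 1, beta != 1 &
        k = eta [set: 'S_n]%G
              ((alpha ^: [set: 'S_n]) * (beta ^: [set: 'S_n]))].

Definition is_least (P : nat -> Prop) (m : nat) : Prop :=
  P m /\ forall k : nat, P k -> (m <= k)%N.

(* Main.v *)
Require Import Defs.
From mathcomp Require Import all_boot all_fingroup.
From mathcomp Require Import cyclic pgroup sylow.
From mathcomp Require Import zify.

(** For a, c in S_n write agree a c = {x | a x = c x}; it is the set of fixed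
    points of a * b when c = b^-1, so counting the values of #|agree a (c ^ g)|
    bounds eta from below.  Prescribing the conjugator g on a few points forces
    agreements, while averaging over all g that are fixed outside a set R shows
    that some g gives few further agreements.  Comparing these two bounds for
    configurations with more and more prescribed agreements separates two, and
    for n prime to 6 three, values.  The only exception is a transposition
    times a fixed-point-free permutation, where the fixed points of the square
    of the product are needed as well.  The bounds are attained by a
    transposition together with an involution having at most one fixed point,
    or with a product of n / 3 disjoint 3-cycles: the centralizer of that
    permutation has two (or three) orbits on pairs of points. *)

Set Implicit Arguments.
Unset Strict Implicit.
Unset Printing Implicit Defensive.

(** * Counting agreements *)

Section Agreements.
Local Open Scope group_scope.
Variable T : finType.
Implicit Types (a c g h : {perm T}) (R P S : {set T}) (u v x y z : T).

Definition fixed a := [set x | a x == x].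
Definition moved a := [set x | a x != x].
Definition agree a c := [set x | a x == c x].

Lemma card_moved a : (#|fixed a| + #|moved a|)%N = #|T|.
Proof.
rewrite -(cardsC (fixed a)); congr (_ + _)%N.
by apply: eq_card => x; rewrite !inE.
Qed.

Lemma fixedJ a g : fixed (a ^ g) = g @: fixed a.
Proof.
apply/setP=> x; apply/idP/imsetP => [|[y]].
  rewrite inE => /eqP e; exists (g^-1 x); last by rewrite permKV.
  by rewrite inE; apply/eqP/(@perm_inj _ g); rewrite -permJ !permKV.
by rewrite !inE => /eqP e ->; rewrite permJ e.
Qed.

Lemma card_fixedJ a g : #|fixed (a ^ g)| = #|fixed a|.
Proof. by rewrite fixedJ card_imset //; apply: perm_inj. Qed.

Lemma card_movedJ a g : #|moved (a ^ g)| = #|moved a|.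
Proof. by have := card_moved (a ^ g); have := card_moved a; rewrite card_fixedJ; lia. Qed.

Lemma agreeC a c : agree a c = agree c a.
Proof. by apply/setP=> x; rewrite !inE eq_sym. Qed.

Lemma agreeJ a c g : agree (a ^ g) (c ^ g) = g @: agree a c.
Proof.
apply/setP=> x; apply/idP/imsetP => [|[y]].
  rewrite inE => e; exists (g^-1 x); last by rewrite permKV.
  rewrite inE; apply/eqP/(@perm_inj _ g).
  by rewrite -(permJ a) -(permJ c) !permKV; apply/eqP.
by rewrite !inE => /eqP e ->; rewrite !permJ e.
Qed.

Lemma card_agreeJ a c g : #|agree a (c ^ g)| = #|agree (a ^ g^-1) c|.
Proof.
by rewrite -[RHS](card_imset _ (@perm_inj _ g)) -agreeJ conjgKV.
Qed.

Lemma fixedM a c g : fixed (a * c ^ g) = agree a (c^-1 ^ g).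
Proof.
apply/setP=> x; rewrite !inE permM conjVg.
by apply/eqP/eqP => [{2}<-|->]; rewrite ?permK ?permKV.
Qed.

(** Right multiplication by [tperm z y] exchanges the fibre of [h v] over [z] with the one over [y],
    so all fibres over [S] have equal size. *)
Lemma card_fiber (A : {set {perm T}}) S v y :
    y \in S -> {in A, forall h, h v \in S} ->
    (forall h z, z \in S -> h \in A -> h * tperm z y \in A) ->
  (#|S| * #|[set h in A | h v == y]|)%N = #|A|.
Proof.
move=> yS vS At; rewrite -[RHS]sum1_card (partition_big (fun h => h v) (mem S)) //=.
rewrite -sum_nat_const; apply: eq_bigr => z zS.
rewrite sum1dep_card; apply/eqP; rewrite eqn_leq; apply/andP; split.
  rewrite -[leqLHS](card_imset _ (mulIg (tperm z y))); apply/subset_leq_card/subsetP => ?.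
  case/imsetP => h; rewrite !inE => /andP[hA /eqP hv] ->.
  by rewrite At //= permM hv tpermR.
rewrite -[leqLHS](card_imset _ (mulIg (tperm z y))); apply/subset_leq_card/subsetP => ?.
case/imsetP => h; rewrite !inE => /andP[hA /eqP hv] ->.
by rewrite At //= permM hv tpermL.
Qed.

Lemma Sym_tperm R h x y : x \in R -> y \in R -> h \in Sym R -> h * tperm x y \in Sym R.
Proof.
rewrite !inE => xR yR hR; apply: perm_onM => //.
apply: subset_trans (tperm_on x y) _.
by apply/subsetP=> z; rewrite !inE => /orP[]/eqP->.
Qed.

Lemma card_Sym1 R u x : u \in R -> x \in R ->
  (#|R| * #|[set h in Sym R | h u == x]|)%N = #|Sym R|.
Proof.
move=> uR xR; apply: card_fiber => // [h|h z zR]; last exact: Sym_tperm.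
by rewrite inE => hR; rewrite perm_closed.
Qed.

Lemma card_Sym2 R u v x y :
    u \in R -> v \in R -> u != v -> x \in R -> y \in R -> x != y ->
  (#|R| * #|R|.-1 * #|[set h in Sym R | (h u == x) && (h v == y)]|)%N = #|Sym R|.
Proof.
move=> uR vR uv xR yR xy; rewrite -(card_Sym1 uR xR) -mulnA.
rewrite (cardsD1 x R) xR add1n /=; congr (_ * _)%N.
have -> : [set h in Sym R | (h u == x) && (h v == y)] =
          [set h in [set h in Sym R | h u == x] | h v == y].
  by apply/setP => h; rewrite !inE andbA.
apply: card_fiber => [|h|h z].
- by rewrite !inE eq_sym xy.
- rewrite !inE => /andP[hR /eqP hu]; rewrite perm_closed // vR andbT -hu.
  by rewrite (inj_eq perm_inj) eq_sym.
rewrite !inE => /andP[zx zR] /andP[hR /eqP hu].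
have /[!inE] -> //= := @Sym_tperm R h z y zR yR.
by rewrite permM hu tpermD // eq_sym.
Qed.

(** With [a] seen as the set of edges [x -> a x], these are the non-loop edges inside [R], the ones
    on which a conjugator supported on [R] can lay an edge of [c]. *)
Definition inner a R := [set x in R | (a x \in R) && (a x != x)].

(** Since [c ^ h] sends [h u] to [h (c u)], these are the [h] for which the image of the edge of [c]
    at [u] is an agreement. *)
Definition hits R a c u := [set h in Sym R | a (h u) == h (c u)].

Lemma sum_agree R a c :
  (\sum_(h in Sym R) #|agree a (c ^ h)| = \sum_u #|hits R a c u|)%N.
Proof.
transitivity (\sum_(h in Sym R) \sum_u (a (h u) == h (c u)))%N.
  apply: eq_bigr => h _; rewrite -sum1dep_card big_mkcond /=.
  rewrite (reindex_inj (@perm_inj _ h)) /=; apply: eq_bigr => u _.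
  by rewrite permJ; case: eqP.
rewrite exchange_big; apply: eq_bigr => u _ /=.
rewrite -sum1dep_card big_mkcondr /=; apply: eq_bigr => h _.
by case: eqP.
Qed.

Section Hits.
Variables (R : {set T}) (a c : {perm T}) (u : T).
Hypothesis cu : u \in R -> c u != u.

Lemma hits_out : u \notin R -> c u \notin R ->
  #|hits R a c u| = ((a u == c u) * #|Sym R|)%N.
Proof.
move=> uR cR.
have -> : hits R a c u = [set h in Sym R | a u == c u].
  apply/setP=> h; rewrite !inE; case hR: (perm_on R h) => //=.
  by rewrite !(out_perm hR).
case: eqP => _; last by rewrite mul0n; apply: eq_card0 => h; rewrite !inE andbF.
by rewrite mul1n; apply: eq_card => h; rewrite !inE andbT.
Qed.

(** Only [h (c u)] varies: it is uniform on [R] and has to hit the single point [a u]. *)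
Lemma hits_leave : u \notin R -> c u \in R ->
  (#|R| * #|hits R a c u|)%N = ((a u \in R) * #|Sym R|)%N.
Proof.
move=> uR cR.
have -> : hits R a c u = [set h in Sym R | h (c u) == a u].
  apply/setP=> h; rewrite !inE; case hR: (perm_on R h) => //=.
  by rewrite !(out_perm hR uR) eq_sym.
case: (boolP (a u \in R)) => aR; first by rewrite card_Sym1 ?mul1n.
rewrite mul0n; suff -> : [set h in Sym R | h (c u) == a u] = set0 by rewrite cards0 muln0.
apply/setP=> h; rewrite !inE; apply/negbTE/negP => /andP[hR /eqP e].
by move: aR; rewrite -e perm_closed ?cR.
Qed.

Lemma hits_enter : u \in R -> c u \notin R ->
  (#|R| * #|hits R a c u|)%N = ((a^-1 (c u) \in R) * #|Sym R|)%N.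
Proof.
move=> uR cR.
have -> : hits R a c u = [set h in Sym R | h u == a^-1 (c u)].
  apply/setP=> h; rewrite !inE; case hR: (perm_on R h) => //=.
  rewrite !(out_perm hR cR).
  by apply/eqP/eqP => [<-|->]; rewrite ?permK ?permKV.
case: (boolP (a^-1 (c u) \in R)) => aR; first by rewrite card_Sym1 ?mul1n.
rewrite mul0n; suff -> : [set h in Sym R | h u == a^-1 (c u)] = set0 by rewrite cards0 muln0.
apply/setP=> h; rewrite !inE; apply/negbTE/negP => /andP[hR /eqP e].
by move: aR; rewrite -e perm_closed ?uR.
Qed.

(** For uniform [h] in [Sym R] the pair [(h u, h (c u))] is uniform among the ordered pairs of
    distinct points of [R], and it has to be an edge of [a]. *)
Lemma hits_inner : u \in R -> c u \in R ->
  (#|R| * #|R|.-1 * #|hits R a c u|)%N = (#|inner a R| * #|Sym R|)%N.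
Proof.
move=> uR cR; have cuu := cu uR.
have -> : #|hits R a c u| =
   (\sum_(x in inner a R) #|[set h in Sym R | (h u == x) && (h (c u) == a x)]|)%N.
  rewrite -sum1_card (partition_big (fun h : {perm T} => h u) (mem (inner a R))) /=.
    apply: eq_bigr => x _; rewrite -sum1_card; apply: eq_bigl => h.
    rewrite !inE; case: (h u =P x) => [<-|_]; rewrite ?andbF //= andbT.
    by rewrite eq_sym.
  move=> h; rewrite !inE => /andP[hR /eqP ->].
  by rewrite !(perm_closed _ hR) uR cR (inj_eq perm_inj).
rewrite big_distrr /= -[RHS]sum_nat_const; apply: eq_bigr => x.
by rewrite !inE => /and3P[xR aR ax]; apply: card_Sym2; rewrite // eq_sym.
Qed.

End Hits.

(** If the mean is at most [d / r] and no term is below [d / r], all terms equal it. The second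
    alternative is recorded because one term known to be larger then forces another strictly
    below. *)
Lemma average (I : finType) (A : {set I}) (F : I -> nat) i r d :
    i \in A -> (r * \sum_(j in A) F j <= #|A| * d)%N ->
  (exists2 j, j \in A & (r * F j < d)%N) \/ {in A, forall j, (r * F j = d)%N}.
Proof.
move=> iA; rewrite big_distrr /= -[leqRHS]sum_nat_const => le.
case: (boolP [exists j in A, r * F j < d]%N) => [/exists_inP[j]|/exists_inPn no].
  by left; exists j.
right=> j jA; apply/eqP; rewrite eqn_leq leqNgt.
have ge k : k \in A -> (d <= r * F k)%N by move/no; rewrite -leqNgt.
rewrite ge // andbT; apply/negP => lt; move: le; apply/negP; rewrite -ltnNge.
rewrite (bigD1 j) //= [ltnRHS](bigD1 j) //= -addSn leq_add //.
by apply: leq_sum => k /andP[kA _]; apply: ge.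
Qed.

End Agreements.

(** * Averaging over conjugators supported on a set *)

Section Averaging.
Local Open Scope group_scope.
Variable T : finType.
Implicit Types (a c g h : {perm T}) (R P S : {set T}) (u v x y z : T).

Lemma conj_Sym_out R c h u : h \in Sym R -> u \notin R -> c u \notin R -> (c ^ h) u = c u.
Proof.
rewrite inE => hR uR cR; rewrite -{1}(out_perm hR uR) permJ.
exact: out_perm hR cR.
Qed.

Section Closed.
Variables (R : {set T}) (a c : {perm T}).
Hypothesis cfix : {in R, forall u, c u != u}.
Hypothesis cR : forall u, (c u \in R) = (u \in R).
Hypothesis R1 : 1 < #|R|.

(** Agreements outside [R] survive every [h]; each of the [#|R|] edges of [c] inside [R] agrees with
    probability [#|inner a R| / (#|R| * #|R|.-1)]. *)
Lemma closed_sum : (#|R|.-1 * \sum_(h in Sym R) #|agree a (c ^ h)| =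
  #|Sym R| * (#|R|.-1 * #|agree a c :\: R| + #|inner a R|))%N.
Proof.
apply/eqP; rewrite -(@eqn_pmul2l #|R|) ?(ltnW R1) //; apply/eqP.
rewrite sum_agree (bigID (mem R)) /= !mulnDr addnC; congr (_ + _)%N.
  have -> : (\sum_(u | u \notin R) #|hits R a c u| = #|Sym R| * #|agree a c :\: R|)%N.
    rewrite -[#|agree a c :\: R|]sum1_card big_distrr /=.
    rewrite [RHS](eq_bigl (fun u => (u \notin R) && (a u == c u))); last first.
      by move=> u; rewrite !inE.
    rewrite big_mkcondr; apply: eq_bigr => u uR.
    by rewrite hits_out ?cR //; case: eqP; rewrite ?mul1n ?muln1.
  by rewrite (mulnCA #|Sym R|).
rewrite mulnA big_distrr /=.
rewrite (eq_bigr (fun u => #|inner a R| * #|Sym R|)%N) => [|u uR].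
  by rewrite sum_nat_const (mulnC #|Sym R|).
by rewrite hits_inner ?cR // => _; apply: cfix.
Qed.

Lemma closed_average : exists h,
  (#|agree a c :\: R| <= #|agree a (c ^ h)|)%N /\
  (#|R|.-1 * #|agree a (c ^ h)| <= #|R|.-1 * #|agree a c :\: R| + #|inner a R|)%N.
Proof.
have ge h : h \in Sym R -> (#|agree a c :\: R| <= #|agree a (c ^ h)|)%N.
  move=> hR; apply/subset_leq_card/subsetP => u; rewrite in_setD => /andP[uR].
  by rewrite !inE (conj_Sym_out hR) // cR.
have := eq_leq closed_sum; case/(average (group1 (Sym_group R))) => [[h hR lt]|eq].
  by exists h; split; [apply: ge | apply: ltnW].
exists 1; split; first exact/ge/(group1 (Sym_group R)).
by rewrite eq ?(group1 (Sym_group R)).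
Qed.

End Closed.

(** * Averaging with a prescribed common path from p to q *)

Section Path.
Variables (P : {set T}) (p q : T) (a c : {perm T}).
Hypothesis cfix : {in ~: P, forall u, c u != u}.
Hypothesis pP : p \in P.
Hypothesis qP : q \in P.
Hypothesis cP : {in P :\ q, forall u, c u \in P :\ p}.
Hypothesis ac : {in P :\ q, forall u, a u = c u}.
Hypothesis cq : c q \notin P.
Hypothesis aP : P \subset moved a.

Let im_cP : c @: (P :\ q) = P :\ p.
Proof.
apply/eqP; rewrite eqEcard; apply/andP; split.
  by apply/subsetP=> ? /imsetP[u uP ->]; apply: cP.
rewrite card_imset; last exact: perm_inj.
by have := cardsD1 q P; have := cardsD1 p P; rewrite pP qP; lia.
Qed.

(** The points of [P] other than [p] already have their [c]-preimages in [P], so an edge of [c] can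
    enter [P] only at [p]. *)
Let c_enter u : u \notin P -> (c u \in P) = (c u == p).
Proof.
move=> uP; apply/idP/eqP => [cuP|->//]; apply/eqP/negPn/negP => ne.
have : c u \in P :\ p by rewrite !inE ne.
rewrite -im_cP => /imsetP[v]; rewrite inE => /andP[_ vP] /perm_inj e.
by rewrite e vP in uP.
Qed.

Let p0 := c^-1 p.

Let p0P : p0 \notin P.
Proof.
apply/negP => p0P; have [e|ne] := eqVneq p0 q.
  by move: cq; rewrite -e permKV pP.
by have := cP (_ : p0 \in P :\ q); rewrite permKV !inE ne eqxx p0P => /(_ isT).
Qed.

(** Let [R = ~: P]. The edges along the path always agree. The edge leaving at [q] agrees with
    probability at most [1 / #|R|], the edge entering at [p] with probability [1 / #|R|] or 0, and
    the [#|R| - 1] edges of [c] inside [R] contribute [#|inner a R| / #|R|] together. *)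
Lemma path_sum : (#|~: P| * \sum_(h in Sym (~: P)) #|agree a (c ^ h)| <=
  #|Sym (~: P)| * (#|P|.-1 * #|~: P| + (#|moved a| - #|P|.-1)))%N.
Proof.
set R := ~: P.
have R_gt0 : (0 < #|R|)%N by apply/card_gt0P; exists p0; rewrite inE.
have cP0 : (0 < #|P|)%N by apply/card_gt0P; exists p.
have H1 : (\sum_(u in P :\ q) #|hits R a c u| = #|P|.-1 * #|Sym R|)%N.
  rewrite (eq_bigr (fun u => #|Sym R|)) => [|u uP].
    by rewrite sum_nat_const (cardsD1 q P) qP.
  have := cP uP; have := ac uP; move: uP; rewrite !inE => /andP[_ uP] e /andP[_ cuP].
  by rewrite hits_out ?inE ?uP ?cuP // e eqxx mul1n.
have H2 : (#|R| * #|hits R a c q| <= #|Sym R|)%N.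
  by rewrite hits_leave ?inE ?qP // -[leqRHS]mul1n leq_mul // leq_b1.
have p0R : p0 \in R by rewrite inE.
have H3 : (#|R| * #|hits R a c p0| = (a^-1 p \in R) * #|Sym R|)%N.
  by rewrite hits_enter // ?inE permKV ?pP.
have H4 : (#|R| * \sum_(u in R :\ p0) #|hits R a c u| <= #|inner a R| * #|Sym R|)%N.
  have [R1|R1] := leqP #|R|.-1 0.
    rewrite big_pred0 ?muln0 // => u; apply/negP => uR.
    have : (0 < #|R :\ p0|)%N by apply/card_gt0P; exists u.
    by have := cardsD1 p0 R; rewrite p0R; lia.
  rewrite -(leq_pmul2l R1) mulnA (mulnC #|R|.-1 #|R|) big_distrr /=.
  rewrite (eq_bigr (fun u => #|inner a R| * #|Sym R|)%N) => [|u].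
    by rewrite sum_nat_const (cardsD1 p0 R) p0R.
  rewrite in_setD1 => /andP[ne uR]; have uP : u \notin P by rewrite -in_setC.
  rewrite hits_inner // ?inE ?c_enter // => [_|]; first exact: cfix.
  by apply: contraNneq ne; rewrite /p0 => <-; rewrite permK.
(* If [a^-1 p] lies outside [P], it is a moved point that [inner a R] does not count, since [a]
   sends it into [P]. *)
have H5 : ((a^-1 p \in R) + #|inner a R| + #|P| <= #|moved a|)%N.
  have := cardsID P (moved a); rewrite (setIidPr aP) => <-.
  rewrite addnC leq_add2l; set Q := moved a :\: P.
  have iQ : inner a R \subset Q.
    by apply/subsetP=> x; rewrite !inE => /and3P[-> _ ->].
  case: (boolP (a^-1 p \in R)) => aR; last exact: subset_leq_card.
  have pQ : a^-1 p \in Q.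
    move: aR; rewrite !inE => aR; rewrite aR permKV eq_sym.
    by rewrite andTb; apply: contraNneq aR => ->.
  rewrite (cardsD1 (a^-1 p) Q) pQ leq_add2l; apply/subset_leq_card/subsetP => x xi.
  rewrite in_setD1 (subsetP iQ) // andbT; apply: contraTneq xi => ->.
  by rewrite !inE permKV pP andbF.
rewrite sum_agree (bigID (mem P)) /= (bigD1 q) //=.
rewrite (eq_bigl (mem (P :\ q))) => [|u]; last by rewrite !inE andbC.
rewrite H1 [X in (_ + _ + X)%N](bigD1 p0) //=.
rewrite [X in (_ + (_ + X))%N](eq_bigl (mem (R :\ p0))) => [|u]; last by rewrite !inE andbC.
rewrite -/R; move: H2 H3 H4 H5; move: (\sum_(_ in R :\ p0) _)%N => Y H2 H3 H4 H5.
have H6 : ((1 + (a^-1 p \in R) + #|inner a R|) * #|Sym R| <=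
           (#|moved a| - #|P|.-1) * #|Sym R|)%N by rewrite leq_mul2r; lia.
have -> : (#|Sym R| * (#|P|.-1 * #|R| + (#|moved a| - #|P|.-1)) =
  #|R| * (#|P|.-1 * #|Sym R|) + (#|moved a| - #|P|.-1) * #|Sym R|)%N.
  by rewrite mulnDr mulnA mulnC (mulnC #|Sym R| (_ - _)) (mulnC #|Sym R|).
rewrite !mulnDr H3 [(#|R| * #|hits R a c q| + _)%N]addnC -addnA leq_add2l.
by apply: leq_trans H6; rewrite !mulnDl mul1n -addnA !leq_add.
Qed.

Lemma path_le h : h \in Sym (~: P) -> (#|P|.-1 <= #|agree a (c ^ h)|)%N.
Proof.
move=> hP; have -> : #|P|.-1 = #|P :\ q| by rewrite (cardsD1 q P) qP.
apply/subset_leq_card/subsetP => u uP; have := cP uP; have := ac uP.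
move: uP; rewrite !inE => /andP[_ uP] -> /andP[_ cuP].
by rewrite (conj_Sym_out hP) ?inE ?uP ?cuP.
Qed.

Lemma path_average : exists h, (#|P|.-1 <= #|agree a (c ^ h)|)%N /\
  (#|~: P| * #|agree a (c ^ h)| <= #|P|.-1 * #|~: P| + (#|moved a| - #|P|.-1))%N.
Proof.
have S1 := group1 (Sym_group (~: P)).
case: (average S1 path_sum) => [[h hR lt]|eq].
  by exists h; split; [apply: path_le | apply: ltnW].
by exists 1; split; [apply: path_le | rewrite eq].
Qed.

(** The identity conjugator exceeds the bound on the mean, which rules out equality throughout. *)
Lemma path_average_lt :
    (#|P|.-1 * #|~: P| + (#|moved a| - #|P|.-1) < #|~: P| * #|agree a c|)%N ->
  exists h,
  (#|~: P| * #|agree a (c ^ h)| < #|P|.-1 * #|~: P| + (#|moved a| - #|P|.-1))%N.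
Proof.
have S1 := group1 (Sym_group (~: P)).
case: (average S1 path_sum) => [[h hR lt]|eq]; first by exists h.
by rewrite -(eq _ S1) conjg1 ltnn.
Qed.

End Path.

End Averaging.

(** * Prescribed agreements *)

Section Patterns.
Local Open Scope group_scope.
Variable T : finType.
Implicit Types (a c g h : {perm T}) (R P S : {set T}) (u v x y z : T).

Lemma uniq_size_card (l : seq T) S : uniq l -> {subset l <= S} -> (size l <= #|S|)%N.
Proof.
by move=> Ul lS; rewrite -(card_uniqP Ul); apply/subset_leq_card/subsetP.
Qed.

Lemma avoid (l : seq T) : (size l < #|T|)%N -> exists x, x \notin l.
Proof.
move=> lt; have /card_gt0P[x xl] : (0 < #|~: [set x in l]|)%N.
  by rewrite cardsCs setCK subn_gt0 cardsE (leq_ltn_trans (card_size l)).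
by exists x; move: xl; rewrite !inE.
Qed.

Lemma match_perm (us xs : seq T) : uniq us -> uniq xs -> size us = size xs ->
  exists g, map g us = xs.
Proof.
(* [ext] completes a duplicate-free list to an enumeration of [T]; the permutation sought matches
   two such enumerations position by position. *)
move=> Uu Ux sz; pose ext (l : seq T) := l ++ [seq x <- enum T | x \notin l].
have Ue l : uniq l -> uniq (ext l).
  move=> Ul; rewrite cat_uniq Ul filter_uniq ?enum_uniq // andbT.
  by apply/hasPn => x; rewrite mem_filter => /andP[].
have me l x : x \in ext l by rewrite mem_cat mem_filter mem_enum; case: (x \in l).
have se : size (ext us) = size (ext xs).
  have szT l : uniq l -> size (ext l) = #|T|.
    by move/Ue/card_uniqP <-; apply: eq_card => x; rewrite me.
  by rewrite !szT.
have gI : injective (fun u => nth u (ext xs) (index u (ext us))).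
  move=> u v /= e.
  have /eqP : nth u (ext xs) (index u (ext us)) = nth u (ext xs) (index v (ext us)).
    by rewrite e; apply: set_nth_default; rewrite -se index_mem.
  move: e => _; rewrite nth_uniq ?Ue -?se ?index_mem // => /eqP e.
  by rewrite -(nth_index u (me us u)) e nth_index.
have [us0|us0] := posnP (size us).
  by exists 1; move: sz; rewrite (size0nil us0) => /esym/size0nil ->.
have [u0 _] : exists u0, u0 \in us.
  by case: (us) us0 => // u l _; exists u; rewrite mem_head.
exists (perm gI); apply: (@eq_from_nth _ u0) => [|i]; first by rewrite size_map.
rewrite size_map => li; rewrite (nth_map u0) // permE.
rewrite [in index _ _]/ext index_cat mem_nth // index_uniq // nth_cat -sz li.
by apply: set_nth_default; rewrite -sz.
Qed.

Lemma agree_ge a c (l : seq T) : uniq l -> {in l, forall x, c x = a x} ->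
  (size l <= #|agree a c|)%N.
Proof. by move=> Ul lS; apply: uniq_size_card => // x /lS; rewrite inE => ->. Qed.

(* A pair (i, j) in I says that both permutations send the i-th point of
   their list to the j-th one. *)
Lemma pattern a c (x0 : T) (us xs : seq T) (I : seq (nat * nat)) :
    uniq us -> uniq xs -> size us = size xs -> uniq (unzip1 I) ->
    all (fun ij => [&& ij.1 < size us, ij.2 < size us,
          c (nth x0 us ij.1) == nth x0 us ij.2 &
          a (nth x0 xs ij.1) == nth x0 xs ij.2]%N) I ->
  exists g, map g us = xs /\ (size I <= #|agree a (c ^ g)|)%N.
Proof.
move=> Uu Ux sz UI /allP HI; have [g gE] := match_perm Uu Ux sz.
have H ij : ij \in I -> (c ^ g) (nth x0 xs ij.1) = nth x0 xs ij.2.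
  by move/HI => /and4P[i1 i2 /eqP ci _]; rewrite -gE !(nth_map x0) // permJ ci.
exists g; split=> //.
have -> : size I = size [seq nth x0 xs i | i <- unzip1 I] by rewrite !size_map.
apply: agree_ge => [|x /mapP[_ /mapP[ij ijI ->] ->]].
  rewrite map_inj_in_uniq // => i j /mapP[ii iI ->] /mapP[jj jI ->] /eqP.
  by case/and4P: (HI _ iI) (HI _ jI) => ? _ _ _ /and4P[? _ _ _];
     rewrite nth_uniq -?sz // => /eqP.
by rewrite H //; case/and4P: (HI _ ijI) => _ _ _ /eqP.
Qed.

Lemma moved_neq1 a : a != 1 -> exists x, a x != x.
Proof.
move=> a1; apply/existsP/existsPn => H; case/eqP: a1; apply/permP => x.
by rewrite perm1; apply/eqP/negPn; apply: H.
Qed.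

(** A point outside [e], which contains [l] and the preimages of [l], is outside [l] together with
    its image. *)
Lemma edge_avoid a (l e : seq T) : uniq l -> {subset l <= e} ->
    {in l, forall x, a^-1 x \in e} -> (size e < #|moved a|)%N ->
  exists z, a z != z /\ uniq [:: z, a z & l].
Proof.
move=> Ul le ale lt; have [z] : exists z, z \in moved a :\: [set x in e].
  apply/card_gt0P; rewrite cardsD subn_gt0; apply: leq_ltn_trans lt.
  apply: leq_trans (card_size e); apply/subset_leq_card/subsetP => x.
  by rewrite !inE => /andP[].
rewrite !inE => /andP[ze az]; exists z; split=> //=.
rewrite inE negb_or eq_sym az Ul (contra (@le z)) // !andbT /=.
by apply: contra ze => /ale; rewrite permK.
Qed.

Lemma one_edge a : a != 1 -> exists x, uniq [:: x; a x].
Proof. by case/moved_neq1 => x ax; exists x; rewrite /= inE eq_sym ax. Qed.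

Lemma two_edges a : (3 < #|moved a|)%N -> exists x y, uniq [:: y; a y; x; a x].
Proof.
move=> s4; have [|x U] := @one_edge a.
  apply: contraTneq s4 => ->; rewrite (_ : moved 1 = set0) ?cards0 //.
  by apply/setP=> x; rewrite !inE perm1 eqxx.
have [||y [_ Uy]] := @edge_avoid a _ [:: a^-1 x; x; a x] U _ _ s4.
- by move=> y; rewrite !inE => /orP[] ->; rewrite ?orbT.
- by move=> y; rewrite !inE => /orP[] /eqP->; rewrite ?permK eqxx ?orbT.
by exists x, y.
Qed.

Lemma card_moved_gt1 a : a != 1 -> (1 < #|moved a|)%N.
Proof.
case/one_edge => x U; have := @uniq_size_card _ (moved a) U; apply => y.
rewrite !inE => /orP[] /eqP ->; last rewrite (inj_eq perm_inj).
  all: by move: U; rewrite /= inE eq_sym => /andP[].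
Qed.

Definition attains3 a c := exists g1 g2 g3,
  (#|agree a (c ^ g1)| < #|agree a (c ^ g2)| < #|agree a (c ^ g3)|)%N.

Lemma attains3C a c : attains3 a c -> attains3 c a.
Proof.
case=> g1 [g2 [g3]]; rewrite !card_agreeJ ![agree (_ ^ _) _]agreeC => H.
by exists g1^-1, g2^-1, g3^-1.
Qed.

(** The conjugator sends [j] fixed points of [c] to fixed points of [a] and the others to moved
    points of [a]. *)
Lemma place_fixed a c j : (j <= #|fixed a|)%N -> (j <= #|fixed c|)%N ->
  (#|fixed c| - j <= #|moved a|)%N -> exists g, #|fixed a :&: fixed (c ^ g)| = j.
Proof.
move=> ja jc jm.
pose xs := take j (enum (fixed a)) ++ take (#|fixed c| - j) (enum (moved a)).
have st k S : (k <= #|S|)%N -> size (take k (enum S)) = k.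
  by move=> kS; rewrite size_takel // -cardE.
have Ux : uniq xs.
  rewrite cat_uniq !take_uniq ?enum_uniq // andbT; apply/hasPn => x /mem_take.
  by rewrite mem_enum inE => ax; apply/negP => /mem_take; rewrite mem_enum inE (negbTE ax).
have [|g gE] := match_perm (enum_uniq (fixed c)) Ux.
  by rewrite size_cat !st // -cardE subnKC.
exists g; rewrite fixedJ -(st j (fixed a)) // -(card_uniqP _) ?take_uniq ?enum_uniq //.
apply: eq_card => x.
have -> : (x \in fixed a :&: (g @: fixed c)) = (x \in fixed a) && (x \in xs).
  rewrite -gE inE; congr (_ && _); apply/imsetP/mapP => [][y yc ->]; exists y => //.
    by rewrite mem_enum.
  by rewrite -(mem_enum (fixed c)).
rewrite mem_cat; apply/andP/idP => [[]|xt].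
  rewrite inE => ax /orP[//|/mem_take]; rewrite mem_enum inE ax //.
by split; [move/mem_take: xt; rewrite mem_enum | rewrite xt].
Qed.

(** Once the fixed points are placed, the average runs over [Sym (moved c')] for the resulting
    conjugate [c']: the agreements outside are the [j] common fixed points, and the [#|fixed c| - j]
    points moved by [a] but fixed by [c'] are lost for [inner]. *)
Lemma fixed_average a c j : (1 < #|moved c|)%N -> (j <= #|fixed a|)%N ->
    (j <= #|fixed c|)%N -> (#|fixed c| - j <= #|moved a|)%N ->
  exists g, (j <= #|agree a (c ^ g)|)%N /\
   (#|moved c|.-1 * #|agree a (c ^ g)| <=
    #|moved c|.-1 * j + (#|moved a| - (#|fixed c| - j)))%N.
Proof.
move=> t1 ja jc jm; have [g gj] := place_fixed ja jc jm; set c' := c ^ g.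
have mf u : (u \in moved c') = ~~ (u \in fixed c') by rewrite !inE.
have [|||h [jle le]] := @closed_average _ (moved c') a c'.
- by move=> u; rewrite inE.
- by move=> u; rewrite !inE (inj_eq perm_inj).
- by rewrite card_movedJ.
have mj : #|agree a c' :\: moved c'| = j.
  rewrite -gj; apply: eq_card => u; rewrite !inE -/c' negbK.
  by case: (c' u =P u) => [->|]; rewrite ?andbF ?andbT.
rewrite mj card_movedJ in jle le.
exists (g * h); rewrite conjgM -/c'; split=> //.
apply: leq_trans le _; rewrite leq_add2l.
have := cardsID (fixed c') (moved a); have := cardsID (fixed a) (fixed c').
rewrite (setIC (fixed c')) gj card_fixedJ.
have -> : fixed c' :\: fixed a = moved a :&: fixed c'.
  by apply/setP=> x; rewrite !inE.
have : (#|inner a (moved c')| <= #|moved a :\: fixed c'|)%N; last by lia.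
by apply/subset_leq_card/subsetP=> x; rewrite !inE => /and3P[-> _ ->].
Qed.

(** With [j] the least possible number of common fixed points, averaging gives exactly [j]
    agreements; with [j.+1] common fixed points it gives [j.+1] or [j.+2]; with [j.+2] of them and
    one common edge there are at least [j.+3]. *)
Lemma attains3_fixed2 a c : a != 1 -> c != 1 ->
  (1 < #|fixed c| <= #|fixed a|)%N -> attains3 a c.
Proof.
move=> a1 c1 /andP[fc fa]; have s2 := card_moved_gt1 a1; have t2 := card_moved_gt1 c1.
have na := card_moved a; have nc := card_moved c.
(* By truncated subtraction [j] is 0 when the two sets of fixed points can be made disjoint. *)
pose j := (#|fixed a| + #|fixed c| - #|T|)%N.
have [||||g1 [l1 u1]] := @fixed_average a c j; rewrite ?/j; try lia.
have [||||g2 [l2 u2]] := @fixed_average a c j.+1; rewrite ?/j; try lia.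
have [m [jm ma mc]] : exists m, [/\ j.+2 <= m, m <= #|fixed a| & m <= #|fixed c|]%N.
  by exists j.+2; rewrite /j; split; lia.
have [x Ux] := one_edge a1; have [u Uu] := one_edge c1.
pose xs := [:: x, a x & take m (enum (fixed a))].
pose us := [:: u, c u & take m (enum (fixed c))].
have U (b : {perm T}) y : uniq [:: y; b y] -> uniq [:: y, b y & take m (enum (fixed b))].
  rewrite /= !inE negb_or !andbT take_uniq ?enum_uniq // => /[dup] ne -> /=.
  rewrite andbT; apply/andP; split; apply/negP=> /mem_take; rewrite mem_enum inE.
    by rewrite eq_sym (negbTE ne).
  by rewrite (inj_eq perm_inj) eq_sym (negbTE ne).
have st (b : {perm T}) : (m <= #|fixed b|)%N -> size (take m (enum (fixed b))) = m.
  by move=> H; rewrite size_takel // -cardE.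
(* One common edge on the first two positions, then [m] loops for the common fixed points. *)
pose I := (0%N, 1%N) :: [seq (i.+2, i.+2) | i <- iota 0 m].
have nf (b : {perm T}) y i : (i < m)%N -> (m <= #|fixed b|)%N ->
    b (nth y (take m (enum (fixed b))) i) = nth y (take m (enum (fixed b))) i.
  move=> im jb; have := mem_nth y (_ : (i < size (take m (enum (fixed b))))%N).
  by rewrite st // => /(_ im) /mem_take; rewrite mem_enum inE => /eqP.
have [|||||g3 [_ l3]] := @pattern a c x us xs I; try exact: U.
- by rewrite /= !st.
- rewrite /unzip1 /= -map_comp map_inj_uniq ?iota_uniq ?andbT.
    by apply/mapP => [[]].
  by move=> ? ? [].
- rewrite /= !eqxx /=; apply/allP => ij /mapP[i]; rewrite mem_iota => /andP[_ im] ->.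
  by rewrite /= st // !ltnS im !nf ?eqxx.
rewrite /= size_map size_iota in l3.
exists g1, g2, g3; move: l1 u1 l2 u2 l3.
move: #|agree a (c ^ g1)| #|agree a (c ^ g2)| #|agree a (c ^ g3)| => X1 X2 X3 l1 u1 l2 u2 l3.
have e1 : (X1 < j.+1)%N.
  rewrite -(@ltn_pmul2l #|moved c|.-1) ?mulnS; last by lia.
  by apply: leq_ltn_trans u1 _; rewrite /j; lia.
have e2 : (X2 < j.+3)%N.
  rewrite -(@ltn_pmul2l #|moved c|.-1) ?(mulnS _ j.+2) ?(mulnS _ j.+1); last by lia.
  by apply: leq_ltn_trans u2 _; rewrite /j; lia.
by lia.
Qed.

End Patterns.

(** * At most one fixed point *)

Section FixedPoints.
Local Open Scope group_scope.
Variable T : finType.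
Implicit Types (a c g h : {perm T}) (R P S : {set T}) (u v x y z : T).

Lemma fixed_notin a x (l : seq T) : a x = x -> all (fun y => a y != y) l -> x \notin l.
Proof. by move=> ax /allP al; apply/negP => /al; rewrite ax eqxx. Qed.

(** Putting the fixed point of [c] on a moved point of [a] leads to no agreement, putting it on a
    fixed point of [a] to one or two; prescribing further edges exceeds that. *)
Lemma attains3_fixed1 a c : (5 < #|T|)%N -> a != 1 -> #|fixed c| = 1%N ->
  (0 < #|fixed a|)%N -> attains3 a c.
Proof.
move=> n6 a1 fc fa; have s2 := card_moved_gt1 a1.
have na := card_moved a; have nc := card_moved c.
have [|||g0 g0E] := @place_fixed _ a c 0; rewrite ?fc //; try lia.
pose c' := c ^ g0; have mf u : (u \in moved c') = ~~ (u \in fixed c') by rewrite !inE.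
have [|||h [_ le]] := @closed_average _ (moved c') a c'.
- by move=> u; rewrite inE.
- by move=> u; rewrite !inE (inj_eq perm_inj).
- by rewrite card_movedJ; lia.
have m0 : #|agree a c' :\: moved c'| = 0%N.
  rewrite -g0E; apply: eq_card => u; rewrite !inE -/c' negbK.
  by case: (c' u =P u) => [->|]; rewrite ?andbF ?andbT.
have /cards1P[p pE] : #|fixed c'| == 1%N by rewrite card_fixedJ fc.
have pa : p \in moved a.
  have := in_set0 p; rewrite -(cards0_eq g0E) -/c' pE !inE eqxx andbT.
  by move->.
(* Neither [p] nor [a^-1 p] starts an edge of [a] inside [moved c']; the loss of these two points
   brings the mean below 1. *)
have iP : (#|inner a (moved c')| <= #|moved a :\ p :\ a^-1 p|)%N.
  apply/subset_leq_card/subsetP=> x; rewrite in_set !mf pE !in_set1 !inE.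
  case/and3P=> -> ax ->; rewrite !andbT; apply: contra ax => /eqP->.
  by rewrite permKV.
have p' : a^-1 p \in moved a :\ p.
  rewrite !inE permKV [in X in _ && X]eq_sym andbb.
  by apply: contraTneq pa => e; rewrite inE -{1}e permKV eqxx.
have c1 := cardsD1 p (moved a); have c2 := cardsD1 (a^-1 p) (moved a :\ p).
rewrite pa p' in c1 c2; rewrite m0 card_movedJ muln0 add0n in le.
have X0 : #|agree a (c ^ (g0 * h))| = 0%N.
  rewrite conjgM -/c'; apply/eqP; rewrite -leqn0 -ltnS.
  rewrite -(@ltn_pmul2l #|moved c|.-1) ?muln1; last by lia.
  by apply: leq_ltn_trans le _; lia.
have [||||g2 [l2 u2]] := @fixed_average _ a c 1%N; rewrite ?fc; try lia.
rewrite fc muln1 subnn subn0 in u2.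
have /card_gt0P[x0] := fa; rewrite inE => /eqP ax0.
have /card_gt0P[u0] : (0 < #|fixed c|)%N by rewrite fc.
rewrite inE => /eqP cu0.
suff [g3 H] : exists g3, (#|agree a (c ^ g2)| < #|agree a (c ^ g3)|)%N.
  by exists (g0 * h), g2, g3; rewrite X0 l2 H.
(* With at most three moved points [g2] gives one agreement, and one extra edge suffices. Otherwise
   it gives at most two, and there is room for two disjoint edges. *)
have [s3|s4] := leqP #|moved a| 3.
  have X1 : (#|agree a (c ^ g2)| < 2)%N.
    rewrite -(@ltn_pmul2l #|moved c|.-1); last by lia.
    by apply: leq_ltn_trans u2 _; lia.
  have [x Ux] := one_edge a1.
  have [|u Uu] := @one_edge _ c.
    apply: contraTneq n6 => c1'; have : moved c = set0.
      by apply/setP=> y; rewrite c1' !inE perm1 eqxx.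
    by move=> mc; rewrite mc cards0 in nc; lia.
  have [|||||g3 [_ l3]] := @pattern _ a c x0 [:: u0; u; c u] [:: x0; x; a x]
     [:: (0, 0); (1, 2)]%N => //.
  - rewrite cons_uniq Uu andbT; apply: fixed_notin cu0 _.
    by move: Uu; rewrite /= !inE !andbT (inj_eq perm_inj) eq_sym => ->.
  - rewrite cons_uniq Ux andbT; apply: fixed_notin ax0 _.
    by move: Ux; rewrite /= !inE !andbT (inj_eq perm_inj) eq_sym => ->.
  - by rewrite /= ax0 cu0 !eqxx.
  by exists g3; apply: leq_trans l3.
have X1 : (#|agree a (c ^ g2)| < 3)%N.
  rewrite -(@ltn_pmul2l #|moved c|.-1); last by lia.
  by apply: leq_ltn_trans u2 _; lia.
have [x [y Ux]] := two_edges s4.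
have [|u [v Uu]] := @two_edges _ c; first by lia.
have U (b : {perm T}) z0 z1 z2 : b z0 = z0 -> uniq [:: z1; b z1; z2; b z2] ->
    uniq [:: z0; z1; b z1; z2; b z2].
  move=> bz Uz; rewrite cons_uniq Uz andbT; apply: fixed_notin bz _.
  move: Uz; rewrite /= !inE !andbT !(inj_eq perm_inj) ![b _ == _]eq_sym.
  by rewrite !negb_or => /and3P[/and3P[-> _ _] _ ->].
have [|||||g3 [_ l3]] := @pattern _ a c x0 [:: u0; v; c v; u; c u]
   [:: x0; y; a y; x; a x] [:: (0, 0); (1, 2); (3, 4)]%N => //; try exact: U.
  by rewrite /= ax0 cu0 !eqxx.
by exists g3; apply: leq_trans l3.
Qed.

Lemma uniq_traject a x k : (forall i, (0 < i <= k)%N -> iter i a x != x) ->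
  uniq (traject a x k.+1).
Proof.
elim: k x => [|k IH] x Hx //; rewrite trajectS cons_uniq IH ?andbT => [|i ik].
  apply/trajectP => -[i ik]; rewrite -iterSr => e.
  by have := Hx i.+1 ik; rewrite -e eqxx.
by rewrite -iterSr iterS (inj_eq perm_inj) Hx //; lia.
Qed.

(** [k] counts edges, so the path has [k.+1] points. A path of [c] is conjugated onto one of [a];
    the last hypothesis says that the path of [c] does not close up, so that [c] leaves it at its
    end. *)
Lemma traject_average a c x u k : (forall v, c v != v) -> a x != x ->
    uniq (traject a x k.+1) -> uniq (traject c u k.+1) -> iter k.+1 c u != u ->
  exists g, (k <= #|agree a (c ^ g)|)%N /\
    ((#|T| - k.+1) * #|agree a (c ^ g)| <=
     k * (#|T| - k.+1) + (#|moved a| - k))%N.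
Proof.
move=> cfix ax Ux Uu cu.
have [|g gE] := match_perm Uu Ux; first by rewrite !size_traject.
have gi i : (i <= k)%N -> g (iter i c u) = iter i a x.
  move=> ik; rewrite -(@nth_traject _ c i k.+1 ik) -(@nth_traject _ a i k.+1 ik) -gE.
  by rewrite (nth_map u) ?size_traject.
have ne i j : (i <= k)%N -> (j <= k)%N -> iter i c u = iter j c u -> i = j.
  move=> ik jk; rewrite -(@nth_traject _ c i k.+1 ik) -(@nth_traject _ c j k.+1 jk).
  by move/eqP; rewrite nth_uniq ?size_traject // => /eqP.
have ca i : (i < k)%N -> (c ^ g) (iter i a x) = iter i.+1 a x.
  by move=> ik; rewrite -gi ?(ltnW ik) // permJ -iterS gi.
pose P := [set y in traject a x k.+1].
have cardP : #|P| = k.+1 by rewrite cardsE (card_uniqP Ux) size_traject.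
have PP y : reflect (exists2 i, (i < k.+1)%N & y = iter i a x) (y \in P).
  by rewrite inE; apply: trajectP.
have Pq y : y \in P :\ iter k a x -> exists2 i, (i < k)%N & y = iter i a x.
  rewrite in_setD1 => /andP[yk /PP[i ik e]]; exists i => //.
  by move: ik; rewrite ltnS leq_eqVlt => /orP[/eqP ei|//]; rewrite e ei eqxx in yk.
have [|||||||h [l1 l2]] := @path_average _ P x (iter k a x) a (c ^ g).
- move=> y _; rewrite -(permKV g y) permJ (inj_eq perm_inj); exact: cfix.
- by apply/PP; exists 0%N.
- by apply/PP; exists k.
- move=> _ /Pq[i ik ->]; rewrite ca // in_setD1; apply/andP; split.
    rewrite -(gi i.+1 ik) -[X in _ != X](gi 0%N isT) (inj_eq perm_inj).
    by apply/eqP => /(ne i.+1 0%N ik isT).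
  by apply/PP; exists i.+1.
- by move=> _ /Pq[i ik ->]; rewrite ca.
- apply/PP => -[i ik]; rewrite -gi // permJ -(gi i) // => /perm_inj.
  rewrite -iterS; case: i ik => [|i] ik; first by move/eqP; apply/negP.
  rewrite !iterS => /perm_inj /(ne k i (leqnn k) (ltnW (ik : i < k)%N)) e.
  by move: ik; rewrite e ltnn.
- apply/subsetP => _ /PP[i ik ->]; rewrite inE -iterS iterSr.
  by elim: (i) => //= j IH; rewrite (inj_eq perm_inj).
have cP : #|~: P| = (#|T| - k.+1)%N by rewrite cardsCs setCK cardP.
by exists (g * h); rewrite conjgM; rewrite cardP cP in l1 l2.
Qed.

(** Averaging around a single point gives no agreement if [a] moves at most three points, and at
    most one in general; one or two prescribed edges do better. *)
Lemma derangement_two_values a c : (5 < #|T|)%N -> a != 1 -> (forall u, c u != u) ->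
  exists g1 g2, (#|agree a (c ^ g1)| < #|agree a (c ^ g2)|)%N.
Proof.
move=> n6 a1 cfix; have [x Ux] := one_edge a1.
have ax : a x != x by move: Ux; rewrite /= inE eq_sym andbT.
have na := card_moved a.
have [|||g [_ le]] := @traject_average a c x x 0 cfix ax; rewrite //=.
rewrite subn0 in le.
have [s3|s4] := leqP #|moved a| 3.
  have X0 : (#|agree a (c ^ g)| < 1)%N.
    rewrite -(@ltn_pmul2l (#|T| - 1)); last by lia.
    by apply: leq_ltn_trans le _; lia.
  have [|||||g3 [_ l3]] := @pattern _ a c x [:: x; c x] [:: x; a x] [:: (0, 1)]%N => //.
  - by rewrite /= inE eq_sym cfix.
  - by rewrite /= !eqxx.
  by exists g, g3; apply: leq_trans l3.
have X0 : (#|agree a (c ^ g)| < 2)%N.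
  rewrite -(@ltn_pmul2l (#|T| - 1)); last by lia.
  by apply: leq_ltn_trans le _; lia.
have [z [y Uz]] := two_edges s4.
have [|u [v Uu]] := @two_edges _ c.
  by rewrite (_ : moved c = setT) ?cardsT; [lia|apply/setP=> w; rewrite !inE cfix].
have [|||||g3 [_ l3]] := @pattern _ a c x [:: v; c v; u; c u] [:: y; a y; z; a z]
   [:: (0, 1); (2, 3)]%N => //.
  by rewrite /= !eqxx.
by exists g, g3; apply: leq_trans l3.
Qed.

(** Otherwise [c] generates a [p]-group acting without fixed points, and [p] divides [#|T|]. *)
Lemma derangement_pow c p e : prime p -> (forall u, c u != u) -> ~~ (p %| #|T|)%N ->
  exists u, iter (p ^ e)%N c u != u.
Proof.
move=> pp cfix pT; apply/existsP; apply: contraNT pT => /existsPn no.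
have ce : c ^+ (p ^ e)%N = 1.
  apply/permP => u; rewrite permX perm1; apply/eqP/negPn/no.
have pg : p.-group <[c]>.
  apply: (@pnat_dvd _ (p ^ e)%N); first by rewrite order_dvdn ce.
  by rewrite pnatX pnat_id.
have := @pgroup_fix_mod _ _ _ 'P p <[c]>%G setT pg.
rewrite cardsT /dvdn => -> //; last by apply/subsetP => g _; rewrite !inE; apply/subsetP => u; rewrite !inE.
rewrite (_ : 'Fix_(_ | _)(_) = set0) ?cards0 ?mod0n //.
apply/setP => u; rewrite !inE; apply/negbTE/negP => /subsetP /(_ c (cycle_id c)).
by rewrite !inE /= /aperm (negbTE (cfix u)).
Qed.

End FixedPoints.

(** * Fixed-point-free permutations *)

Section ThreeValues.
Local Open Scope group_scope.
Variable T : finType.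
Implicit Types (a c g h : {perm T}) (R P S : {set T}) (u v x y z : T).

Lemma edge_avoid_traject a x k : (0 < k)%N -> uniq (traject a x k) ->
    (k.+1 < #|moved a|)%N ->
  exists z, a z != z /\ uniq [:: z, a z & traject a x k].
Proof.
move=> k0 U lt; apply: (@edge_avoid _ _ _ (a^-1 x :: traject a x k)) => //.
- by move=> y yt; rewrite inE yt orbT.
- move=> _ /trajectP[[|i] ik ->]; rewrite inE ?eqxx // iterS permK.
  by apply/orP; right; apply/trajectP; exists i; rewrite // ltnW.
- by rewrite /= size_traject.
Qed.

Lemma uniq_traject3 a x : a (a x) != x -> uniq (traject a x 3).
Proof.
move=> ax; apply: uniq_traject => -[|[|[]]] //= _.
by apply: contra ax => /eqP e; rewrite !e.
Qed.

(** Either [a] has a path of two edges to match with that of [c], or it is an involution with two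
    disjoint edges. *)
Lemma derangement_two_agree a c u : (3 < #|T|)%N -> (forall v, c v != v) ->
  c (c u) != u -> (2 < #|moved a|)%N -> exists g, (1 < #|agree a (c ^ g)|)%N.
Proof.
move=> n4 cfix cu s3.
have mc : moved c = setT by apply/setP=> v; rewrite !inE cfix.
have [/existsP[x ax]|/existsPn aI] := boolP [exists x, a (a x) != x].
  have [|||||g [_ l]] := @pattern _ a c x (traject c u 3) (traject a x 3)
    [:: (0, 1); (1, 2)]%N; try exact: uniq_traject3; rewrite //=.
    by rewrite !eqxx.
  by exists g.
have aV y : a^-1 y = a y by apply: (@perm_inj _ a); rewrite permKV; apply/esym/eqP/negPn/aI.
have [x Ux] : exists x, uniq [:: x; a x].
  apply: one_edge; apply: contraTneq s3 => ->; rewrite (_ : moved 1 = set0) ?cards0 //.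
  by apply/setP=> x; rewrite !inE perm1 eqxx.
have [|||y [_ Uy]] := @edge_avoid _ a _ [:: x; a x] Ux => //.
  by apply/allP; rewrite /= !inE permK aV !eqxx ?orbT.
have [|v [w Uv]] := @two_edges _ c; first by rewrite mc cardsT.
have [|||||g [_ l]] := @pattern _ a c x [:: w; c w; v; c v] [:: y; a y; x; a x]
    [:: (0, 1); (2, 3)]%N => //.
  by rewrite /= !eqxx.
by exists g.
Qed.

Lemma derangement_three_agree a c u : (6 < #|T|)%N -> (forall v, c v != v) ->
  c (c u) != u -> (5 < #|moved a|)%N -> exists g, (2 < #|agree a (c ^ g)|)%N.
Proof.
move=> n7 cfix cu s6.
have mc : #|moved c| = #|T|.
  by rewrite (_ : moved c = setT) ?cardsT //; apply/setP=> v; rewrite !inE cfix.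
have [/existsP[x ax]|/existsPn aI] := boolP [exists x, a (a x) != x].
  have [|||y [_ Uy]] := @edge_avoid_traject a x 3; rewrite ?uniq_traject3 //; try lia.
  have [|||v [_ Uv]] := @edge_avoid_traject c u 3; rewrite ?uniq_traject3 ?mc //; try lia.
  have [|||g [_ l]] := @pattern _ a c x _ _ [:: (0, 1); (2, 3); (3, 4)]%N Uv Uy => //.
    by rewrite /= !eqxx.
  by exists g.
have aV y : a^-1 y = a y by apply: (@perm_inj _ a); rewrite permKV; apply/esym/eqP/negPn/aI.
have [x Ux] : exists x, uniq [:: x; a x].
  apply: one_edge; apply: contraTneq s6 => ->; rewrite (_ : moved 1 = set0) ?cards0 //.
  by apply/setP=> x; rewrite !inE perm1 eqxx.
have [|||y [_ Uy]] := @edge_avoid _ a _ [:: x; a x] Ux => //.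
- by apply/allP; rewrite /= !inE !permK !aV !eqxx ?orbT.
- by rewrite /=; lia.
have [|||z [_ Uz]] := @edge_avoid _ a _ [:: y; a y; x; a x] Uy => //.
- by apply/allP; rewrite /= !inE !permK !aV !eqxx ?orbT.
- by rewrite /=; lia.
have [v1 [v2 Uv]] : exists x y, uniq [:: y; c y; x; c x] by apply: two_edges; lia.
(* [c] need not be an involution, so the preimages of [v1] and [v2] are avoided separately. *)
have [|||v3 [_ Uv3]] := @edge_avoid _ c _
   [:: c^-1 v2; c^-1 v1; v2; c v2; v1; c v1] Uv => //.
- by apply/allP; rewrite /= !inE !eqxx ?orbT.
- by apply/allP; rewrite /= !inE !permK !eqxx ?orbT.
- by rewrite /=; lia.
have [|||g [_ l]] := @pattern _ a c x _ _ [:: (0, 1); (2, 3); (4, 5)]%N Uv3 Uz => //.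
  by rewrite /= !eqxx.
by exists g.
Qed.

(** If [a] fixes at least two points, averaging with no or one prescribed edge gives exactly 0 and
    1, and two agreements can be prescribed. If [a] fixes just one, the values are 0, then 1 or 2,
    then at least 3. *)
Lemma attains3_few a c : (6 < #|T|)%N -> ~~ (2 %| #|T|)%N -> (forall u, c u != u) ->
  (2 < #|moved a| < #|T|)%N -> attains3 a c.
Proof.
move=> n7 n2 cfix /andP[s3 sn].
have [u cu] := @derangement_pow _ c 2 1 isT cfix n2.
have [x ax] : exists x, a x != x.
  by have /card_gt0P[x] : (0 < #|moved a|)%N by [lia]; rewrite inE; exists x.
have [|||g2 [l2 u2]] := @traject_average _ a c x u 1 cfix ax.
- by rewrite /= inE eq_sym ax.
- by rewrite /= inE eq_sym cfix.
- exact: cu.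
have [sn2|sn1] := leqP #|moved a| (#|T| - 2).
  have [|||g1 [_ u1]] := @traject_average _ a c x u 0 cfix ax; rewrite //= ?cfix //.
  have [|g3 l3] := derangement_two_agree _ cfix cu s3; first by lia.
  have e1 : (#|agree a (c ^ g1)| < 1)%N.
    rewrite -(@ltn_pmul2l (#|T| - 1)); last by lia.
    by apply: leq_ltn_trans u1 _; lia.
  have e2 : (#|agree a (c ^ g2)| < 2)%N.
    rewrite -(@ltn_pmul2l (#|T| - 2)); last by lia.
    by apply: leq_ltn_trans u2 _; lia.
  by exists g1, g2, g3; lia.
(* The mean with no prescribed edge is only bounded by 1 here, which does not yet give the value 0.
   A conjugate with three agreements lies above that bound and so forces another one below it. *)
have [|g3 l3] := derangement_three_agree n7 cfix cu (_ : 5 < #|moved a|)%N; first by lia.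
have [||||||||h] := @path_average_lt _ [set x] x x a (c ^ g3).
- move=> y _; rewrite -(permKV g3 y) permJ (inj_eq perm_inj); exact: cfix.
- by rewrite inE.
- by rewrite inE.
- by move=> y; rewrite !inE => /andP[/negbTE ->].
- by move=> y; rewrite !inE => /andP[/negbTE ->].
- by rewrite inE -(permKV g3 x) permJ (inj_eq perm_inj); apply: cfix.
- by rewrite sub1set inE.
- rewrite cards1 [#|~: _|]cardsCs setCK cards1 mul0n add0n subn0.
  by apply: (@leq_ltn_trans ((#|T| - 1) * 1)); [lia | rewrite ltn_pmul2l; lia].
rewrite cards1 [#|~: _|]cardsCs setCK cards1 mul0n add0n subn0 => u1.
have e1 : (#|agree a ((c ^ g3) ^ h)| < 1)%N.
  rewrite -(@ltn_pmul2l (#|T| - 1)); last by lia.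
  by apply: leq_trans u1 _; lia.
have e2 : (#|agree a (c ^ g2)| < 3)%N.
  rewrite -(@ltn_pmul2l (#|T| - 2)); last by lia.
  by apply: leq_ltn_trans u2 _; lia.
by exists (g3 * h), g2, g3; rewrite conjgM (leq_trans e1 l2) (leq_trans e2 l3).
Qed.

(** For [a] without fixed points: some cycle has length at least 4. *)
Definition has_path4 a := [exists x, (a (a x) != x) && (a (a (a x)) != x)].
(** For [a] without fixed points: some cycle has length exactly 3. *)
Definition has_cycle3 a := [exists x, a (a (a x)) == x].

Section TwoDerangements.
Variables a c : {perm T}.
Hypothesis n7 : (6 < #|T|)%N.
Hypothesis n2 : ~~ (2 %| #|T|)%N.
Hypothesis n3 : ~~ (3 %| #|T|)%N.
Hypothesis afix : forall u, a u != u.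
Hypothesis cfix : forall u, c u != u.

Let mv (b : {perm T}) : (forall u, b u != u) -> #|moved b| = #|T|.
Proof. by move=> bfix; rewrite -cardsT; apply: eq_card => x; rewrite !inE bfix. Qed.

Lemma le_one_agree : exists g, (#|agree a (c ^ g)| <= 1)%N.
Proof.
have /card_gt0P[x _] : (0 < #|T|)%N by lia.
have [|||g [_ l]] := @traject_average _ a c x x 0 cfix (afix x); rewrite //= ?cfix //.
exists g; rewrite -ltnS -(@ltn_pmul2l (#|T| - 1)); last by lia.
by apply: leq_ltn_trans l _; rewrite mv //; lia.
Qed.

(** Two prescribed edges use three points, and the mean of the further agreements is at most
    [(#|T| - 2) / (#|T| - 3)], which is below 2. *)
Lemma path3_agree x u : a (a x) != x -> c (c u) != u -> c (c (c u)) != u ->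
  exists g, (1 < #|agree a (c ^ g)| < 4)%N.
Proof.
move=> ax cu cu3.
have [|||g [l1 l2]] := @traject_average _ a c x u 2 cfix (afix x); rewrite ?uniq_traject3 //.
exists g; rewrite l1 /= -(@ltn_pmul2l (#|T| - 3)); last by lia.
by apply: leq_ltn_trans l2 _; rewrite mv //; lia.
Qed.

(** Three consecutive edges and a disjoint one make four agreements, beyond the range of
    [path3_agree]. *)
Lemma attains3_path4 : has_path4 a -> has_path4 c -> attains3 a c.
Proof.
case/existsP=> x /andP[ax ax3] /existsP[u /andP[cu cu3]].
have [g1 l1] := le_one_agree; have [g2 l2] := path3_agree ax cu cu3.
have U4 (b : {perm T}) y : b y != y -> b (b y) != y -> b (b (b y)) != y -> uniq (traject b y 4).
  by move=> H1 H2 H3; apply: uniq_traject => -[|[|[|[]]]].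
have [|||y [_ Uy]] := @edge_avoid_traject a x 4; rewrite ?U4 ?mv //; try lia.
have [|||v [_ Uv]] := @edge_avoid_traject c u 4; rewrite ?U4 ?mv //; try lia.
have [|||g3 [_ l3]] := @pattern _ a c x _ _ [:: (0, 1); (2, 3); (3, 4); (4, 5)]%N Uv Uy => //.
  by rewrite /= !eqxx.
by exists g1, g2, g3; move: l3 l1 l2 => /=; lia.
Qed.

Let cycle3_path (b : {perm T}) x : (forall u, b u != u) -> b (b (b x)) = x -> b (b x) != x.
Proof. by move=> bfix e; apply/eqP => e2; have := bfix x; rewrite -{2}e e2 eqxx. Qed.

(** A common 3-cycle gives three agreements, and averaging over its complement adds at most one; a
    common 3-cycle with two further edges gives five. *)
Lemma attains3_cycle3 : has_cycle3 a -> has_cycle3 c -> attains3 a c.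
Proof.
case/existsP=> x /eqP ax /existsP[u /eqP cu].
have Ua := uniq_traject3 (cycle3_path afix ax).
have Uc := uniq_traject3 (cycle3_path cfix cu).
have [g1 l1] := le_one_agree.
have [|||g [gE _]] := @pattern _ a c x _ _ [:: (0, 1); (1, 2); (2, 0)]%N Uc Ua => //.
  by rewrite /= ax cu !eqxx.
case: gE => gu gcu gccu.
have c0 : (c ^ g) x = a x by rewrite -{1}gu permJ gcu.
have c1 : (c ^ g) (a x) = a (a x) by rewrite -{1}gcu permJ gccu.
have c2 : (c ^ g) (a (a x)) = x by rewrite -{1}gccu permJ cu.
pose P := [set y in traject a x 3].
have cardP : #|P| = 3 by rewrite cardsE (card_uniqP Ua).
have Pc y : ((c ^ g) y \in P) = (y \in P).
  have cE := inj_eq (@perm_inj _ (c ^ g)).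
  rewrite /P !inE -[y == x]cE -[y == a x]cE -[y == a (a x)]cE c0 c1 c2.
  by rewrite orbC orbA.
have [|||h [le1 le2]] := @closed_average _ (~: P) a (c ^ g).
- move=> y _; rewrite -(permKV g y) permJ (inj_eq perm_inj); exact: cfix.
- by move=> y; rewrite !in_setC Pc.
- by rewrite cardsCs setCK cardP; lia.
have m3 : #|agree a (c ^ g) :\: ~: P| = 3.
  rewrite -cardP; apply: eq_card => y; rewrite in_setD in_setC negbK.
  case yP: (y \in P) => //=; move: yP; rewrite !inE.
  by case/or3P => /eqP ->; rewrite ?c0 ?c1 ?c2 ?ax eqxx.
have iR : (#|inner a (~: P)| <= #|T| - 3)%N.
  rewrite -cardP; have -> : (#|T| - #|P|)%N = #|~: P| by rewrite [RHS]cardsCs setCK.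
  by apply/subset_leq_card/subsetP => y; rewrite inE => /andP[].
rewrite m3 [#|~: P|]cardsCs setCK cardP in le1 le2.
have e2 : (#|agree a ((c ^ g) ^ h)| < 5)%N.
  rewrite -(@ltn_pmul2l (#|T| - 3).-1); last by lia.
  by apply: leq_ltn_trans le2 _; lia.
have E (b : {perm T}) y : (forall u, b u != u) -> b (b (b y)) = y ->
  exists z w, uniq [:: w, b w, z, b z & traject b y 3].
  move=> bfix by3; have bV : b^-1 y = b (b y) by rewrite -{1}by3 permK.
  have Ub := uniq_traject3 (cycle3_path bfix by3).
  have [|||z [_ Uz]] := @edge_avoid _ b _ (traject b y 3) Ub => //.
  - by apply/allP; rewrite /= !inE !permK bV !eqxx ?orbT.
  - by rewrite mv //; apply: leq_trans n7.
  have [|||w [_ Uw]] := @edge_avoid _ b _ [:: b^-1 z, z, b z & traject b y 3] Uz => //.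
  - by apply/allP; rewrite /= !inE !eqxx ?orbT.
  - by apply/allP; rewrite /= !inE !permK bV !eqxx ?orbT.
  - by rewrite mv.
  by exists z, w.
have [z [w Uz]] := E a x afix ax; have [v [t Ut]] := E c u cfix cu.
have [|||g3 [_ l3]] := @pattern _ a c x _ _
    [:: (0, 1); (2, 3); (4, 5); (5, 6); (6, 4)]%N Ut Uz => //.
  by rewrite /= ax cu !eqxx.
by exists g1, (g * h), g3; rewrite conjgM (leq_ltn_trans l1 (ltnW le1)) (leq_trans e2 l3).
Qed.

(** All cycles of [a] have length 2 or 3, and both lengths occur because [#|T|] is prime to 6. If
    [c] has no 3-cycle, it has a cycle of length at least 5, along which edges from both kinds of
    cycles of [a] can be matched. *)
Lemma attains3_no_path4 : ~~ has_path4 a -> attains3 a c.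
Proof.
move=> p4.
have small x : a (a x) != x -> a (a (a x)) = x.
  by move=> ax; apply/eqP; apply: contraNT p4 => ax3; apply/existsP; exists x; rewrite ax.
have [x ax2] := @derangement_pow _ a 2 1 isT afix n2; rewrite /= in ax2.
have ax3 := small x ax2.
have a3 : has_cycle3 a by apply/existsP; exists x; rewrite ax3.
have [/(attains3_cycle3 a3)//|/existsPn c3] := boolP (has_cycle3 c).
have [y ay3] := @derangement_pow _ a 3 1 isT afix n3; rewrite /= in ay3.
have ay2 : a (a y) = y by apply/eqP; apply: contraNT ay3 => /small ->.
(* The fourth power excludes the cycle lengths 2 and 4 at [u] at once; 3 is excluded by [c3]. *)
have [u cu4] := @derangement_pow _ c 2 2 isT cfix n2; rewrite /= in cu4.
have cu2 : c (c u) != u by apply: contra cu4 => /eqP e; rewrite !e.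
have U5 : uniq (traject c u 5).
  by apply: uniq_traject => -[|[|[|[|[]]]]] //= _; rewrite ?cfix ?c3.
have [|||v [_ Uv]] := @edge_avoid_traject c u 5; rewrite ?mv //.
have U3 := uniq_traject3 ax2.
have Uy : uniq [:: y, a y & traject a x 3].
  have yx i : y != iter i a x.
    apply: contraNneq ay3 => ->; apply/eqP.
    by rewrite -[LHS]/(iter 3 a _) -iterD addnC iterD /= ax3.
  rewrite 2!cons_uniq U3 andbT inE negb_or eq_sym afix andTb.
  apply/andP; split; apply/trajectP => -[i _ e]; first by case/eqP: (yx i).
  by case/eqP: (yx i.+1); rewrite iterS -e.
have yV : a^-1 y = a y by rewrite -{1}ay2 permK.
have xV : a^-1 x = a (a x) by rewrite -{1}ax3 permK.
have [|||z [_ Uz]] := @edge_avoid _ a _ [:: y, a y & traject a x 3] Uy => //.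
- by apply/allP; rewrite /= !inE !permK yV xV !eqxx ?orbT.
- by rewrite mv //; apply: ltnW n7.
have [g1 l1] := le_one_agree; have [g2 /andP[l2 u2]] := path3_agree ax2 cu2 (c3 u).
(* The five points from [u] on carry the edge at [y] and then the two edges from [x]; the edge
   between these two pieces is left free, and [z] supplies the fourth agreement. *)
have [|||g3 [_ l3]] := @pattern _ a c x _ _ [:: (0, 1); (2, 3); (4, 5); (5, 6)]%N Uv Uz => //.
  by rewrite /= !eqxx.
by exists g1, g2, g3; rewrite (leq_ltn_trans l1 l2) (leq_trans u2 l3).
Qed.
End TwoDerangements.

End ThreeValues.

(** * Products with a transposition *)

Section Transpositions.
Local Open Scope group_scope.
Variable T : finType.
Implicit Types (a c g h : {perm T}) (R P S : {set T}) (u v x y z : T).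

Lemma fixed_eq0 a : #|fixed a| = 0%N -> forall u, a u != u.
Proof.
by move=> a0 u; apply/negP => au; have := card0_eq a0 u; rewrite inE au.
Qed.

Lemma two_values a c : (5 < #|T|)%N -> a != 1 -> c != 1 ->
  exists g1 g2, (#|agree a (c ^ g1)| < #|agree a (c ^ g2)|)%N.
Proof.
move=> n6; wlog le : a c / (#|fixed c| <= #|fixed a|)%N => [IH a1 c1|a1 c1].
  have [le|/ltnW le] := leqP #|fixed c| #|fixed a|; first exact: IH.
  have [g1 [g2]] := IH _ _ le c1 a1; rewrite !card_agreeJ ![agree (_ ^ _) _]agreeC.
  by exists g1^-1, g2^-1.
have three : attains3 a c -> exists g1 g2, (#|agree a (c ^ g1)| < #|agree a (c ^ g2)|)%N.
  by case=> g1 [g2 [g3 /andP[lt _]]]; exists g1, g2.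
case E : #|fixed c| => [|[|k]].
- exact: derangement_two_values (fixed_eq0 E).
- by apply/three/attains3_fixed1; rewrite // -E.
by apply/three/attains3_fixed2; rewrite // le E.
Qed.

Lemma three_values a c : (6 < #|T|)%N -> ~~ (2 %| #|T|)%N -> ~~ (3 %| #|T|)%N ->
    a != 1 -> c != 1 ->
  [\/ attains3 a c, #|moved a| = 2 /\ (forall u, c u != u)
    | #|moved c| = 2 /\ (forall u, a u != u)].
Proof.
move=> n7 n2 n3; wlog le : a c / (#|fixed c| <= #|fixed a|)%N => [IH a1 c1|a1 c1].
  have [le|/ltnW le] := leqP #|fixed c| #|fixed a|; first exact: IH.
  by case: (IH _ _ le c1 a1) => [/attains3C ? | ? | ?]; [apply: Or31|apply: Or33|apply: Or32].
case E : #|fixed c| => [|[|k]].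
- have cfix := fixed_eq0 E; have := card_moved_gt1 a1.
  rewrite leq_eqVlt => /orP[/eqP m2|m3]; first by apply: Or32.
  apply: Or31; have [mn|mn] := ltnP #|moved a| #|T|.
    by apply: attains3_few; rewrite // m3.
  have a0 : #|fixed a| = 0%N by have := card_moved a; lia.
  have afix := fixed_eq0 a0.
  have [pa|pa] := boolP (has_path4 a); last exact: attains3_no_path4.
  have [pc|pc] := boolP (has_path4 c); first exact: attains3_path4.
  by apply/attains3C/attains3_no_path4.
- by apply/Or31/attains3_fixed1; rewrite // ?(ltnW n7) // -E.
by apply/Or31/attains3_fixed2; rewrite // le E.
Qed.

Lemma card_moved2 a : #|moved a| = 2%N -> exists x y, x != y /\ a = tperm x y.
Proof.
move=> a2; have /card_gt0P[x] : (0 < #|moved a|)%N by rewrite a2.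
rewrite inE => ax; exists x, (a x); split; first by rewrite eq_sym.
have mE : [set x; a x] = moved a.
  apply/eqP; rewrite eqEcard cards2 a2 eq_sym ax leqnn andbT.
  by apply/subsetP=> y; rewrite !inE => /orP[]/eqP->; rewrite ?(inj_eq perm_inj).
have aax : a (a x) = x.
  have : a (a x) \in [set x; a x] by rewrite mE inE !(inj_eq perm_inj).
  by rewrite !inE (inj_eq perm_inj) (negbTE ax) orbF => /eqP.
apply/permP => y; case: tpermP => [->|->|yx yax] //.
apply/eqP/negPn/negP => ay; have : y \in moved a by rewrite inE.
by rewrite -mE !inE => /orP[]/eqP.
Qed.

(** The values are 0, 1 and 2; the last one comes from laying the 2-cycle at [v] on the
    transposition. *)
Lemma tperm_attains3 c p q u v : (6 < #|T|)%N -> p != q -> (forall w, c w != w) ->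
  c (c u) != u -> c (c v) = v -> attains3 (tperm p q) c.
Proof.
move=> n7 pq cfix cu cv; set a := tperm p q.
have m2 : #|moved a| = 2%N.
  have qp : q != p by rewrite eq_sym.
  rewrite -(_ : [set p; q] = moved a) ?cards2 ?pq //; apply/setP => w; rewrite !inE.
  by case: tpermP => [->|->|/eqP/negbTE -> /eqP/negbTE ->]; rewrite ?eqxx ?orbT ?pq ?qp.
have ap : a p != p by rewrite tpermL eq_sym.
have [|||g1 [_ l1]] := @traject_average _ a c p u 0 cfix ap; rewrite //= ?cfix //.
have [|||g2 [l2 u2]] := @traject_average _ a c p u 1 cfix ap.
- by rewrite /= inE eq_sym ap.
- by rewrite /= inE eq_sym cfix.
- exact: cu.
have [|||||g3 [_ l3]] := @pattern _ a c p [:: v; c v] [:: p; a p] [:: (0, 1); (1, 0)]%N => //.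
- by rewrite /= inE eq_sym cfix.
- by rewrite /= inE eq_sym ap.
- by rewrite /= cv tpermK !eqxx.
have e1 : (#|agree a (c ^ g1)| < 1)%N.
  rewrite -(@ltn_pmul2l (#|T| - 1)); last by lia.
  by apply: leq_ltn_trans l1 _; rewrite m2; lia.
have e2 : (#|agree a (c ^ g2)| < 2)%N.
  rewrite -(@ltn_pmul2l (#|T| - 2)); last by lia.
  by apply: leq_ltn_trans u2 _; rewrite m2; lia.
by exists g1, g2, g3; rewrite (leq_trans e1 l2) (leq_trans e2 l3).
Qed.

Lemma tperm_split_fixed c p : (forall w, c w != w) -> 
  p \in fixed (c * tperm p (c p)).
Proof. by move=> cfix; rewrite inE permM tpermR. Qed.

Lemma tperm_fixed0 c p q : (forall w, c w != w) -> c p != q -> c q != p ->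
  fixed (c * tperm p q) = set0.
Proof.
move=> cfix cp cq; apply/setP => u; rewrite !inE permM; apply/negbTE/eqP.
case: tpermP => [e e'|e e'|_ _ /eqP]; last exact/negP.
  by case/eqP: cq; rewrite e' e.
by case/eqP: cp; rewrite e' e.
Qed.

Lemma fixed_sqr a : fixed a \subset fixed (a * a).
Proof. by apply/subsetP=> x; rewrite !inE permM => /eqP ax; rewrite !ax. Qed.

Lemma tperm_sqr_fixed c p : (forall w, c w != w) -> c (c p) != p ->
  p \in fixed ((c * tperm p (c (c p))) * (c * tperm p (c (c p)))).
Proof.
move=> cfix cp; rewrite inE !permM.
by rewrite [tperm _ _ (c p)]tpermD ?tpermR // ?(inj_eq perm_inj) ?cfix // eq_sym.
Qed.

(** A transposition joins two cycles of [c] or cuts one into two arcs, whose lengths are the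
    distances between [p] and [q] along [c]. Excluding distances up to 2 in both directions prevents
    cycles of length 1 or 2. *)
Lemma tperm_sqr_fixed0 c p q : (forall w, c (c w) != w) ->
    q \notin [:: p; c p; c (c p); c^-1 p; c^-1 (c^-1 p)] ->
  fixed ((c * tperm p q) * (c * tperm p q)) = set0.
Proof.
move=> c2; rewrite !inE !negb_or => /and5P[qp qcp qccp qvp qvvp].
have cfix w : c w != w by apply: contra (c2 w) => /eqP e; rewrite !e.
apply/setP => u; rewrite !inE !permM; apply/negbTE/eqP => e.
have {}e : c (tperm p q (c u)) = tperm p q u by rewrite -{2}e tpermK.
move: e; case: (tpermP p q (c u)) => [cu|cu|/eqP cup /eqP cuq].
- have eu : u = c^-1 p by rewrite -cu permK.
  rewrite tpermD; first 1 last.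
  + by apply: contraNneq (cfix u) => eu'; rewrite cu eu'.
  + by apply: contraNneq qvp => ->; rewrite eu eqxx.
  by move=> e; case/eqP: qvvp; rewrite -eu -e permK.
- have eu : u = c^-1 q by rewrite -cu permK.
  rewrite tpermD; first 1 last.
  + by apply: contraNneq qcp => ->; rewrite cu eqxx.
  + by apply: contraNneq (cfix u) => eu'; rewrite cu eu'.
  by move=> e; case/eqP: qccp; rewrite e cu.
case: tpermP => [->|->|_ _]; last by move/eqP; apply/negP.
  by move=> e; case/eqP: qccp.
by move=> e; case/eqP: qvvp; rewrite -e !permK.
Qed.

End Transpositions.

(** * Conjugacy classes *)

Section Eta.
Local Open Scope group_scope.
Variables (gT : finGroupType) (G : {group gT}).
Implicit Types (x y z : gT).

Lemma class_mulC x y : x \in G -> y \in G -> (x ^: G) * (y ^: G) = (y ^: G) * (x ^: G).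
Proof.
move=> xG yG; suff sub u v : u \in G -> v \in G -> (u ^: G) * (v ^: G) \subset (v ^: G) * (u ^: G).
  by apply/eqP; rewrite eqEsubset !sub.
move=> uG vG; apply/subsetP => _ /mulsgP[_ _ /imsetP[g gG ->] /imsetP[h hG ->] ->].
by rewrite conjgC -conjgM mem_mulg ?memJ_class // groupM ?groupJ.
Qed.

Lemma class_mul_sub x y d : d \in (x ^: G) * (y ^: G) -> d ^: G \subset (x ^: G) * (y ^: G).
Proof.
case/mulsgP=> _ _ /imsetP[g gG ->] /imsetP[h hG ->] ->.
apply/subsetP => _ /imsetP[k kG ->].
by rewrite conjMg -!conjgM; apply: mem_mulg; apply: memJ_class; rewrite groupM.
Qed.

(** The invariant [f] at a representative recovers [f d] from the class of [d], so distinct values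
    give distinct classes. *)
Lemma eta_ge (I : eqType) (f : gT -> I) x y (ds : seq gT) : x \in G -> y \in G ->
    {in G &, forall d z, f (d ^ z) = f d} ->
    {subset ds <= (x ^: G) * (y ^: G)} -> uniq (map f ds) ->
  (size ds <= eta G ((x ^: G) * (y ^: G))%g)%N.
Proof.
move=> xG yG fJ sub U; have XG : (x ^: G) * (y ^: G) \subset G.
  by rewrite mul_subG // class_subG.
rewrite -(size_map (fun d => d ^: G) ds) /eta.
apply: uniq_size_card => [|_ /mapP[d dds ->]]; last first.
  by rewrite inE mem_classes ?class_mul_sub ?sub // (subsetP XG) ?sub.
apply: (@map_uniq _ _ (fun C : {set gT} => f (repr C))).
rewrite -map_comp (_ : map _ ds = map f ds) //; apply/eq_in_map => d dds /=.
have dG : d \in G by rewrite (subsetP XG) ?sub.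
by have /imsetP[z zG ->] := mem_repr d (class_refl G d); rewrite fJ.
Qed.

Lemma eta_le (A : {set gT}) (ds : seq gT) :
    {in A, forall d, exists2 e, e \in ds & d \in e ^: G} -> (eta G A <= size ds)%N.
Proof.
move=> cover; rewrite -(size_map (fun d => d ^: G) ds).
apply: leq_trans (card_size _); apply/subset_leq_card/subsetP => C.
rewrite inE => /andP[/imsetP[d dG ->] /subsetP sub].
have [e eds /class_eqP ->] := cover d (sub d (class_refl G d)).
exact: map_f.
Qed.

End Eta.

(** * Bounds for eta in the symmetric group *)

Section SymmetricGroup.
Local Open Scope group_scope.
Variable T : finType.
Implicit Types (a b c d g h z : {perm T}) (u v w p q : T).
Let G := [set: {perm T}]%G.

Definition fixed_counts d := (#|fixed d|, #|fixed (d * d)|).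

Lemma fixed_countsJ d z : fixed_counts (d ^ z) = fixed_counts d.
Proof. by rewrite /fixed_counts -conjMg !card_fixedJ. Qed.

Lemma fixed_countsV d : fixed_counts d^-1 = fixed_counts d.
Proof.
have fV a : fixed a^-1 = fixed a.
  by apply/setP=> x; rewrite !inE; apply/eqP/eqP => {1}<-; rewrite ?permK ?permKV.
by rewrite /fixed_counts -invMg !fV.
Qed.

Lemma eta_ge_agree a b (gs : seq {perm T}) :
    uniq [seq #|agree a (b^-1 ^ g)| | g <- gs] ->
  (size gs <= eta G ((a ^: G) * (b ^: G))%g)%N.
Proof.
move=> U; rewrite -(size_map (fun g => a * b ^ g) gs).
apply: (@eta_ge _ _ _ (fun d => #|fixed d|)) => [||d z _ _|_ /mapP[g _ ->]|].
- by rewrite inE.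
- by rewrite inE.
- exact: card_fixedJ.
- by rewrite mem_mulg ?class_refl // memJ_class ?inE // class_refl.
by rewrite -map_comp; under eq_map => g do rewrite /= fixedM.
Qed.

Lemma eta_ge2 a b : (5 < #|T|)%N -> a != 1 -> b != 1 ->
  (1 < eta G ((a ^: G) * (b ^: G))%g)%N.
Proof.
move=> n6 a1 b1; have [|g1 [g2 lt]] := two_values n6 a1 (_ : b^-1 != 1).
  by rewrite invg_eq1.
by apply: (@eta_ge_agree a b [:: g1; g2]); rewrite /= inE ltn_eqF.
Qed.

Lemma eta_ge3_attains a b : attains3 a b^-1 -> (2 < eta G ((a ^: G) * (b ^: G))%g)%N.
Proof.
case=> g1 [g2 [g3 /andP[l1 l2]]].
apply: (@eta_ge_agree a b [:: g1; g2; g3]).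
by rewrite /= !inE !ltn_eqF // (ltn_trans l1 l2).
Qed.

Lemma tperm_conj p q u v : p != q -> u != v -> exists g, tperm p q ^ g = tperm u v.
Proof.
move=> pq uv; have [||//|g [gp gq]] := @match_perm _ [:: p; q] [:: u; v].
- by rewrite /= inE pq.
- by rewrite /= inE uv.
by exists g; rewrite tpermJ gp gq.
Qed.

(** If [b] has a 2-cycle, agreements suffice. Otherwise the transposition is put on points at
    distance one, at distance two and further apart along [c]: the product then has a fixed point, a
    2-cycle but no fixed point, or neither. *)
Lemma eta_ge3_tperm a b : (6 < #|T|)%N -> ~~ (2 %| #|T|)%N -> ~~ (3 %| #|T|)%N ->
    #|moved a| = 2%N -> (forall u, b u != u) ->
  (2 < eta G ((a ^: G) * (b ^: G))%g)%N.
Proof.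
move=> n7 n2 n3 /card_moved2[p0 [q0 [pq0 ->]]] bfix; pose c := b^-1.
have cfix u : c u != u.
  by apply: contra (bfix u) => /eqP e; rewrite -{1}e permKV.
have [u cu] := @derangement_pow _ c 2 1 isT cfix n2; rewrite /= in cu.
have [/existsP[v /eqP cv]|/existsPn c2] := boolP [exists v, c (c v) == v].
  by apply/eta_ge3_attains/(tperm_attains3 n7 pq0 cfix cu cv).
(* [p] has to be off the 3-cycles of [c]: on one of them the second product in [ds] would have a
   fixed point. *)
have [p cp3] := @derangement_pow _ c 3 1 isT cfix n3; rewrite /= in cp3.
have [q qN] : exists q, q \notin [:: p; c p; c (c p); c^-1 p; c^-1 (c^-1 p)].
  by apply: avoid; apply: ltnW n7.
pose ds := [:: tperm p (c p) * b; tperm p (c (c p)) * b; tperm p q * b].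
apply: (@eta_ge _ _ _ fixed_counts _ _ ds) => [||d z _ _|d|].
- by rewrite inE.
- by rewrite inE.
- exact: fixed_countsJ.
- have mem p1 q1 : p1 != q1 -> tperm p1 q1 * b \in (tperm p0 q0 ^: G) * (b ^: G).
    move=> ne; have [g <-] := tperm_conj pq0 ne.
    by rewrite mem_mulg ?class_refl // memJ_class ?inE // class_refl.
  rewrite !inE => /or3P[]/eqP->; apply: mem.
  + by rewrite eq_sym cfix.
  + by rewrite eq_sym c2.
  + by move: qN; rewrite inE negb_or eq_sym => /andP[].
(* Inversion turns [tperm p1 q1 * b] into [c * tperm p1 q1]. *)
have fE p1 q1 : fixed_counts (tperm p1 q1 * b) = fixed_counts (c * tperm p1 q1).
  by rewrite -fixed_countsV invMg tpermV.
rewrite /ds /= !fE /fixed_counts (tperm_sqr_fixed0 c2 qN) cards0.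
have -> : fixed (c * tperm p q) = set0.
  by apply/eqP; rewrite -subset0 -(tperm_sqr_fixed0 c2 qN) fixed_sqr.
have -> : fixed (c * tperm p (c (c p))) = set0.
  by apply: tperm_fixed0; rewrite // eq_sym cfix.
have F1 : (0 < #|fixed (c * tperm p (c p))|)%N.
  by apply/card_gt0P; exists p; apply: tperm_split_fixed.
have F2 : (0 < #|fixed ((c * tperm p (c (c p))) * (c * tperm p (c (c p))))|)%N.
  by apply/card_gt0P; exists p; apply: tperm_sqr_fixed; rewrite ?c2.
by rewrite !inE cards0 !xpair_eqE !eqxx (gtn_eqF F1) (gtn_eqF F2).
Qed.

Lemma eta_ge3 a b : (5 < #|T|)%N -> ~~ (2 %| #|T|)%N -> ~~ (3 %| #|T|)%N ->
  a != 1 -> b != 1 -> (2 < eta G ((a ^: G) * (b ^: G))%g)%N.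
Proof.
move=> n6 n2 n3 a1 b1; have n7 : (6 < #|T|)%N.
  by rewrite ltn_neqAle n6 andbT; apply: contraNneq n2 => <-.
have b1' : b^-1 != 1 by rewrite invg_eq1.
case: (three_values n7 n2 n3 a1 b1') => [|[m2 cfix]|[m2 afix]].
- exact: eta_ge3_attains.
- apply: eta_ge3_tperm => // u; apply: contra (cfix u) => /eqP e.
  by rewrite -{1}e permK.
rewrite class_mulC ?inE //; apply: eta_ge3_tperm => //.
rewrite -m2; apply: eq_card => u; rewrite !inE; congr (~~ _).
by apply/eqP/eqP => {1}<-; rewrite ?permK ?permKV.
Qed.

(* Conjugating by the inverse of the second conjugator fixes b, so that only
   the transposition varies. *)
Lemma eta_le_tperm b p0 q0 (ds : seq {perm T}) : p0 != q0 ->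
    (forall p q, p != q ->
       exists z, z * b = b * z /\ tperm (z p) (z q) * b \in ds) ->
  (eta G ((tperm p0 q0 ^: G) * (b ^: G))%g <= size ds)%N.
Proof.
move=> pq0 H; apply: eta_le => _ /mulsgP[_ _ /imsetP[g _ ->] /imsetP[h _ ->] ->].
have [|z [zb zds]] := H ((g * h^-1) p0) ((g * h^-1) q0).
  by rewrite (inj_eq perm_inj).
exists (tperm (z ((g * h^-1) p0)) (z ((g * h^-1) q0)) * b) => //.
apply/imsetP; exists (z^-1 * h); rewrite ?inE //.
rewrite conjMg -!tpermJ -!conjgM; congr (_ * _); first by congr (_ ^ _); rewrite !mulgA mulgK mulgKV.
by rewrite conjgM (_ : b ^ z^-1 = b) // conjgE invgK mulgA zb mulgK.
Qed.

Lemma commute_tperm u v p q : u != p -> u != q -> v != p -> v != q ->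
  tperm u v * tperm p q = tperm p q * tperm u v.
Proof. by move=> up uq vp vq; rewrite conjgC tpermJ !tpermD // eq_sym. Qed.

(** * Moving points by the centralizer of b *)

Section Centralizer.
Variable b : {perm T}.

Lemma rotate_orbit (S : {set T}) : (forall u, (b u \in S) = (u \in S)) ->
  exists z, [/\ z * b = b * z, {in S, forall u, z u = b u} &
                forall u, u \notin S -> z u = u].
Proof.
move=> bS; have fI : injective (fun u => if u \in S then b u else u).
  move=> u v; case: ifPn => uS; case: ifPn => vS //; first exact: perm_inj.
    by move=> e; rewrite -e bS uS in vS.
  by move=> e; rewrite e bS vS in uS.
exists (perm fI); split=> [|u uS|u uS]; last 2 first.
- by rewrite permE uS.
- by rewrite permE (negbTE uS).
by apply/permP => u; rewrite !permM !permE bS; case: ifP.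
Qed.

Variable k : nat.
Hypothesis k_gt0 : (0 < k)%N.
Hypothesis bk : forall w, iter k b w = w.

(** As [iter k b] is the identity, [traject b v k] runs through the whole orbit of [v]. *)
Lemma mem_traject_sym u v : (u \in traject b v k) = (v \in traject b u k).
Proof.
suff sub p q : p \in traject b q k -> q \in traject b p k by apply/idP/idP; apply: sub.
case/trajectP=> [[|i] ik ->]; first by apply/trajectP; exists 0%N.
apply/trajectP; exists (k - i.+1)%N; first by lia.
by rewrite -iterD subnK ?bk // ltnW.
Qed.

Lemma mem_traject_next u v : (b u \in traject b v k) = (u \in traject b v k).
Proof.
apply/idP/idP; rewrite mem_traject_sym [in X in _ -> X]mem_traject_sym.
  case/trajectP=> i ik ->; apply/trajectP.
  case: (ltnP i.+1 k) => ik1; first by exists i.+1; rewrite // iterSr.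
  exists 0%N => //=; have e : i.+1 = k by lia.
  by rewrite -iterSr e bk.
case/trajectP=> [[|i] ik ->]; apply/trajectP.
  by exists k.-1; rewrite ?prednK // -iterSr prednK // bk.
by exists i; rewrite ?(ltnW ik) // iterSr.
Qed.

(** The centralizer of [b] is transitive on the moved points. The last clause allows a second move
    without spoiling the first, and keeps the fixed points of [b] in place. *)
Definition movable := forall u v, b u != u -> b v != v -> exists z,
  [/\ z * b = b * z, z u = v &
      forall w, w \notin traject b u k -> w \notin traject b v k -> z w = w].

(** Inside one orbit, a power of the permutation that acts as [b] on this orbit and trivially
    elsewhere does the move. *)
Lemma movable_far : 
  (forall u v, b u != u -> b v != v -> v \notin traject b u k -> exists z,
  [/\ z * b = b * z, z u = v &
      forall w, w \notin traject b u k -> w \notin traject b v k -> z w = w]) ->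
  movable.
Proof.
move=> far u v bu bv; case: (boolP (v \in traject b u k)) => [|]; last exact: far.
case/trajectP=> i _ ->.
have [|r [rb rS rN]] := @rotate_orbit [set w in traject b u k].
  by move=> w; rewrite !inE mem_traject_next.
have uS : u \in traject b u k by apply/trajectP; exists 0%N.
have iS j : iter j b u \in traject b u k.
  by elim: j => //= j IH; rewrite mem_traject_next.
exists (r ^+ i); split.
- by have /commute_sym/(commuteX i)/commute_sym : commute r b by [].
- rewrite permX; elim: (i) => //= j ->; rewrite rS // inE; exact: iS.
move=> w wu _; rewrite permX; elim: (i) => //= j ->; rewrite rN // inE.
exact: wu.
Qed.

(** First [p] goes to [x]; the move from the image of [q] to [y] then leaves [x] alone, since [x] is
    on neither orbit. *)
Lemma move_pair p q x y : movable -> b p != p -> b q != q -> b x != x -> b y != y ->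
    q \notin traject b p k -> y \notin traject b x k ->
  exists z, [/\ z * b = b * z, z p = x & z q = y].
Proof.
move=> mv bp bq bx by_ qp yx; have [z1 [z1b z1p _]] := mv p x bp bx.
have z1c w : b (z1 w) = z1 (b w) by rewrite -!permM z1b.
have bq1 : b (z1 q) != z1 q by rewrite z1c (inj_eq perm_inj).
have [z2 [z2b z2q z2N]] := mv (z1 q) y bq1 by_.
exists (z1 * z2); split; last by rewrite permM.
  by rewrite -mulgA z2b mulgA z1b mulgA.
rewrite permM z1p z2N //; last by rewrite mem_traject_sym.
rewrite mem_traject_sym; apply: contra qp => /trajectP[i ik].
rewrite -z1p (_ : iter i b (z1 p) = z1 (iter i b p)) => [/perm_inj ->|].
  by apply/trajectP; exists i.
by elim: (i) => //= j ->; rewrite z1c.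
Qed.

End Centralizer.

Lemma movable2 b : (forall w, b (b w) = w) -> movable b 2.
Proof.
move=> b2; apply: movable_far => // u v bu bv; rewrite /= !inE !negb_or => /andP[vu vbu].
have bvu : b v != u by apply: contra vbu => /eqP <-; rewrite b2.
have buv : b u != v by rewrite eq_sym.
(* This exchanges the 2-cycles of [u] and [v] in step with [b]. *)
exists (tperm u v * tperm (b u) (b v)); split.
- by rewrite conjgC conjMg !tpermJ !b2 [in LHS]commute_tperm.
- by rewrite permM tpermL tpermD // eq_sym.
move=> w; rewrite !inE !negb_or => /andP[wu wbu] /andP[wv wbv].
by rewrite permM !tpermD // eq_sym.
Qed.

Lemma movable3 b : (forall w, b (b (b w)) = w) -> movable b 3.
Proof.
move=> b3; apply: movable_far => // u v bu bv.
rewrite /= !inE !negb_or => /and3P[vu vbu vbbu].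
have E := inj_eq (@perm_inj _ b).
have bbu : b (b u) != u by apply: contra bu => /eqP e; rewrite -{2}(b3 u) e.
have bbv : b (b v) != v by apply: contra bv => /eqP e; rewrite -{2}(b3 v) e.
have bvu : b v != u by apply: contra vbbu => /eqP <-; rewrite b3.
have bbvu : b (b v) != u by apply: contra vbu => /eqP <-; rewrite b3.
have vbvu : b (b v) != b u by rewrite E.
have bvbbu : b v != b (b u) by rewrite E.
have buv : b u != v by rewrite eq_sym.
have bbuv : b (b u) != v by rewrite eq_sym.
(* This exchanges the 3-cycles of [u] and [v] in step with [b]. *)
exists (tperm u v * tperm (b u) (b v) * tperm (b (b u)) (b (b v))); split.
- rewrite conjgC !conjMg !tpermJ !b3; congr (_ * _).
  rewrite -mulgA [in LHS](@commute_tperm (b (b u))) // mulgA.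
  by rewrite [in LHS](@commute_tperm (b u)).
- by rewrite !permM tpermL !tpermD.
move=> w; rewrite !inE !negb_or => /and3P[wu wbu wbbu] /and3P[wv wbv wbbv].
by rewrite !permM !tpermD // eq_sym.
Qed.

(** Up to the centralizer a pair of points is a 2-cycle of [b], meets two different 2-cycles, or
    joins a moved point to the fixed point, if there is one. *)
Lemma eta_involution b p0 q0 : (4 < #|T|)%N -> p0 != q0 -> (forall w, b (b w) = w) ->
    {in fixed b &, forall u v, u = v} ->
  (eta G ((tperm p0 q0 ^: G) * (b ^: G))%g <= 2 + #|fixed b|)%N.
Proof.
move=> n5 pq0 b2 f1; have mv := movable2 b2.
have [x xf] : exists x, x \notin enum (fixed b).
  apply: avoid; rewrite -cardE; apply: leq_trans n5; rewrite ltnS.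
  case: (set_0Vmem (fixed b)) => [->|[f fb]]; first by rewrite cards0.
  suff -> : fixed b = [set f] by rewrite cards1.
  by apply/setP=> u; rewrite in_set1; apply/idP/eqP => [ub|-> //]; apply: f1.
have bx : b x != x by move: xf; rewrite mem_enum inE.
have [y] : exists y, y \notin [:: x, b x & enum (fixed b)].
  apply: avoid; rewrite /= -cardE; apply: leq_trans n5; rewrite !ltnS.
  case: (set_0Vmem (fixed b)) => [->|[f fb]]; first by rewrite cards0.
  suff -> : fixed b = [set f] by rewrite cards1.
  by apply/setP=> u; rewrite in_set1; apply/idP/eqP => [ub|-> //]; apply: f1.
rewrite !inE !negb_or mem_enum inE => /and3P[yx ybx by_].
have -> : (2 + #|fixed b|)%N = size [:: tperm x (b x) * b, tperm x y * b &
    [seq tperm f x * b | f <- enum (fixed b)]] by rewrite /= size_map -cardE.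
have fixd f q : b f = f -> b q != q -> exists z, z * b = b * z /\
   tperm (z f) (z q) * b \in [:: tperm x (b x) * b, tperm x y * b &
    [seq tperm f x * b | f <- enum (fixed b)]].
  move=> bf bq; have [z [zb zq zN]] := mv q x bq bx; exists z; split=> //.
  have fN w : b w != w -> f \notin [:: w; b w].
    move=> bw; rewrite !inE negb_or; apply/andP; split; apply/eqP => e.
      by rewrite -e bf eqxx in bw.
    by move: bf; rewrite e b2 => ew; rewrite -ew eqxx in bw.
  rewrite zq zN ?fN // !inE; apply/orP; right; apply/orP; right.
  by apply/mapP; exists f; rewrite // mem_enum inE bf.
apply: eta_le_tperm => // p q pq.
have [bp|bp] := eqVneq (b p) p; have [bq|bq] := eqVneq (b q) q.
- by case/eqP: pq; apply: f1; rewrite inE ?bp ?bq.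
- exact: fixd.
- by have [z [zb zm]] := fixd q p bq bp; exists z; rewrite tpermC.
have [e|ne] := eqVneq q (b p).
  have [z [zb zp _]] := mv p x bp bx; exists z; split=> //.
  have -> : z q = b x by rewrite e -permM -zb permM zp.
  by rewrite zp mem_head.
have [||z [zb zp zq]] := @move_pair b 2 isT b2 p q x y mv bp bq bx by_.
- by rewrite /= !inE negb_or eq_sym pq.
- by rewrite /= !inE negb_or yx.
by exists z; rewrite zp zq !inE eqxx orbT.
Qed.

(** Unordered pairs form two orbits: inside a 3-cycle, where each is some point with its image under
    [b], and across two 3-cycles. *)
Lemma eta_three_cycles b p0 q0 : (3 < #|T|)%N -> p0 != q0 ->
    (forall w, b w != w) -> (forall w, b (b (b w)) = w) ->
  (eta G ((tperm p0 q0 ^: G) * (b ^: G))%g <= 2)%N.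
Proof.
move=> n4 pq0 bfix b3; have mv := movable3 b3.
have /card_gt0P[x _] : (0 < #|T|)%N by lia.
have [y yN] : exists y, y \notin traject b x 3 by apply: avoid; rewrite size_traject.
apply: (@eta_le_tperm _ _ _ [:: tperm x (b x) * b; tperm x y * b]) => // p q pq.
have near p1 q1 : q1 = b p1 -> exists z, z * b = b * z /\
    tperm (z p1) (z q1) * b \in [:: tperm x (b x) * b; tperm x y * b].
  move=> ->; have [z [zb zp _]] := mv p1 x (bfix _) (bfix _); exists z; split=> //.
  by rewrite -(permM b z) -zb permM zp mem_head.
case: (boolP (q \in traject b p 3)) => [|ne].
  rewrite /= !inE [q == p]eq_sym (negbTE pq) /= => /orP[/eqP e|/eqP e]; first exact: near.
  have [|z [zb zm]] := near q p; first by rewrite e b3.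
  by exists z; rewrite tpermC.
have [z [zb zp zq]] := @move_pair b 3 isT b3 p q x y mv (bfix _) (bfix _) (bfix _) (bfix _) ne yN.
by exists z; rewrite zp zq !inE eqxx orbT.
Qed.

End SymmetricGroup.

(** * Pairs attaining the bounds *)

Section Examples.
Local Open Scope group_scope.
Variable n : nat.
Hypothesis n6 : 5 < n.

Let p0 : 'I_n := Ordinal (ltnW (ltnW (ltnW (ltnW (ltnW n6))))).
Let q0 : 'I_n := Ordinal (ltnW (ltnW (ltnW (ltnW n6)))).

Lemma tperm_neq1 (T : finType) (p q : T) : p != q -> tperm p q != 1.
Proof.
by apply: contraNneq => e; have := tpermL p q; rewrite e perm1 => ->.
Qed.

Lemma neq1_moved (T : finType) (b : {perm T}) x : b x != x -> b != 1.
Proof. by apply: contraNneq => ->; rewrite perm1. Qed.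

Lemma eta_value_reversal : exists2 k, eta_values n k & (k <= 2 + odd n)%N.
Proof.
(* The reversal pairs off the points, except for the middle one when [n] is odd. *)
pose b := perm (@rev_ord_inj n).
have b2 w : b (b w) = w by rewrite !permE rev_ordK.
have bE w : (b w == w) = (n == w.*2.+1).
  by rewrite permE -val_eqE /=; have := ltn_ord w; rewrite -addnn => wn; apply/eqP/eqP; lia.
have f1 : {in fixed b &, forall u v, u = v}.
  move=> u v; rewrite !inE !bE => /eqP e1 /eqP e2.
  by have [/double_inj/ord_inj] := etrans (esym e1) e2.
exists (eta [set: 'S_n]%G ((tperm p0 q0 ^: [set: 'S_n]) * (b ^: [set: 'S_n]))).
  exists (tperm p0 q0), b; split=> //; first exact: tperm_neq1.
  by apply: (@neq1_moved _ _ p0); rewrite bE /=; lia.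
apply: leq_trans (eta_involution _ _ b2 f1) _; rewrite ?card_ord ?(ltnW n6) //.
rewrite leq_add2l; case: (set_0Vmem (fixed b)) => [->|[f]]; first by rewrite cards0.
move=> fb; have -> : fixed b = [set f].
  by apply/setP=> u; rewrite in_set1; apply/idP/eqP => [ub|-> //]; apply: f1.
by move: fb; rewrite inE bE cards1 => /eqP ->; rewrite /= odd_double.
Qed.

Lemma eta_value_rotation : 3 %| n -> exists2 k, eta_values n k & (k <= 2)%N.
Proof.
case/dvdnP=> k nE; have n0 : 0 < n by lia.
(* Rotation by [k = n / 3] is a product of [k] disjoint 3-cycles. *)
pose r (i : 'I_n) : 'I_n := Ordinal (ltn_pmod (i + k) n0).
have r3 : cancel r (r \o r).
  move=> i; apply/val_inj; rewrite /= modnDml -addnA modnDml -addnA.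
  rewrite (_ : (k + (k + k))%N = n) ?modnDr ?modn_small //.
  by lia.
pose b := perm (can_inj r3).
have bfix w : b w != w.
  rewrite permE -val_eqE /=; have wn := ltn_ord w.
  have [lt|ge] := ltnP (w + k)%N n; first by rewrite modn_small //; lia.
  rewrite -(subnK ge) modnDr modn_small; lia.
have b3 w : b (b (b w)) = w by rewrite !permE; apply: r3.
exists (eta [set: 'S_n]%G ((tperm p0 q0 ^: [set: 'S_n]) * (b ^: [set: 'S_n]))).
  exists (tperm p0 q0), b; split=> //; first exact: tperm_neq1.
  exact: neq1_moved (bfix p0).
by apply: eta_three_cycles; rewrite // card_ord ltnW // ltnW.
Qed.

End Examples.

Lemma eta_values_ge2 n k : 5 < n -> eta_values n k -> 1 < k.
Proof. by move=> n6 [a [b [a1 b1 ->]]]; apply: eta_ge2; rewrite ?card_ord. Qed.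

Lemma eta_values_ge3 n k : 5 < n -> ~~ (2 %| n) -> ~~ (3 %| n) -> eta_values n k -> 2 < k.
Proof. by move=> n6 n2 n3 [a [b [a1 b1 ->]]]; apply: eta_ge3; rewrite ?card_ord. Qed.


Theorem corollary1 (n : nat) (hn : 5 < n) :
  exists m : nat,
    [/\ is_least (eta_values n) m,
        (2 %| n) || (3 %| n) -> m = 2
      & ~~ ((2 %| n) || (3 %| n)) -> m = 3].
Proof.
(* The reversal attains 2 for even [n] and 3 for [n] prime to 6; the rotation serves the odd
   multiples of 3. *)
have [k ek k3] := eta_value_reversal hn; case: (boolP (2 %| n)) => n2 /=.
  exists 2; split=> //; split; last by move=> j; apply: eta_values_ge2.
  suff <- : k = 2 by [].
  apply/eqP; rewrite eqn_leq (eta_values_ge2 hn ek) andbT.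
  by move: n2 k3; rewrite dvdn2 => /negbTE ->.
case: (boolP (3 %| n)) => n3 /=.
  have [j ej j2] := eta_value_rotation hn n3.
  exists 2; split=> //; split; last by move=> i; apply: eta_values_ge2.
  suff <- : j = 2 by [].
  by apply/eqP; rewrite eqn_leq j2 (eta_values_ge2 hn ej).
exists 3; split=> //; split; last by move=> i; apply: eta_values_ge3.
suff <- : k = 3 by [].
apply/eqP; rewrite eqn_leq (eta_values_ge3 hn n2 n3 ek) andbT.
by apply: leq_trans k3 _; rewrite leq_add2l leq_b1.
Qed.
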